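(* Suppose that $1\le k\le n-1$, $k$ is even, and $\mu>k$. Then a function $f\in C^k_\mu(\mathbb{R}^n)$ can be reconstructed from its $k$-plane transform $\varphi=Rf$ by the formula $$f(x)=\lim_{r\to0}\,c_k\Big(-\frac{\partial}{\partial r}\Big)^{k}(R^*_x\varphi)(r),\qquad c_k=\frac{(-1)^{k/2}}{(k-1)!\,\sigma_{k-1}},$$ where the limit is uniform on $\mathbb{R}^n$.
   Context: $\sigma_{k-1}=2\pi^{k/2}/\Gamma(k/2)$ is the area of the unit sphere $S^{k-1}$. For $\mu>0$, $k\in\mathbb{N}$, $C^k_\mu(\mathbb{R}^n)=\{f\in C^k(\mathbb{R}^n):\ |\partial^\alpha f(x)|=O(|x|^{-\mu})\ \forall\,|\alpha|\le k\}$ (as $|x|\to\infty$). $\Pi_{n,k}$ is the manifold of all non-oriented $k$-planes $\tau$ in $\mathbb{R}^n$, written $\tau=(\zeta,u)$ with $\zeta$ a $k$-dimensional linear subspace and $u\in\zeta^\perp$. The $k$-plane transform is $(Rf)(\zeta,u)=\int_\zeta f(u+v)\,dv$. For a function $\varphi$ on $\Pi_{n,k}$, $x\in\mathbb{R}^n$, $r>0$, the shifted dual Radon transform is $$(R^*_x\varphi)(r)=\int_{SO(n)}\varphi(\gamma\mathbb{R}^k+x+r\gamma e_n)\,d\gamma,$$ where $\mathbb{R}^k=\mathbb{R}e_1\oplus\cdots\oplus\mathbb{R}e_k$ and $d\gamma$ is the Haar probability measure (the average of $\varphi$ over all $k$-planes at distance $r$ from $x$). *)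

(* Defs.v *)
From HB Require Import structures.
From mathcomp Require Import all_boot all_order all_algebra.
From mathcomp Require Import all_classical all_reals all_analysis.

Set Implicit Arguments.
Unset Strict Implicit.
Unset Printing Implicit Defensive.

Import Order.TTheory GRing.Theory Num.Theory.
Import numFieldNormedType.Exports.
Local Open Scope classical_set_scope.
Local Open Scope ring_scope.

(* Lebesgue measure on R^k, as the k-fold product of the one-dimensional
   Lebesgue measure; points of R^k are k-tuples, which carry the product
   sigma-algebra. *)
Section lebesgue_tuple.
Context {R : realType}.
Local Notation RT := (measurableTypeR R).

Section cons_measure.
Variables (k : nat) (m : {sigma_finite_measure set (k.-tuple RT) -> \bar R}).

Definition cons_pair (p : RT * k.-tuple RT) : k.+1.-tuple RT :=
  [the k.+1.-tuple RT of p.1 :: p.2].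

Definition uncons_pair (t : k.+1.-tuple RT) : RT * k.-tuple RT :=
  (tnth t ord0, [tuple of behead t]).

Lemma cons_pairK : cancel cons_pair uncons_pair.
Proof.
by move=> [a t]; rewrite /uncons_pair; congr pair; apply: val_inj.
Qed.

Lemma measurable_cons_pair : measurable_fun setT cons_pair.
Proof. exact: measurable_cons. Qed.

Lemma measurable_uncons_pair : measurable_fun setT uncons_pair.
Proof.
apply/measurable_fun_pairP; split => /=.
  exact: measurable_tnth.
exact: measurable_behead.
Qed.

Definition cons_measure : set (k.+1.-tuple RT) -> \bar R :=
  pushforward ((lebesgue_measure : {sigma_finite_measure set RT -> \bar R})
                 \x m)%E cons_pair.

Let cons_measure0 : cons_measure set0 = 0%E.
Proof. by rewrite /cons_measure /pushforward preimage_set0 measure0. Qed.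

Let cons_measure_ge0 A : (0 <= cons_measure A)%E.
Proof. by rewrite /cons_measure /pushforward measure_ge0. Qed.

Let cons_measure_sigma_additive : semi_sigma_additive cons_measure.
Proof.
move=> F mF tF mUF; rewrite /cons_measure /pushforward preimage_bigcup.
have mpre A : measurable A -> measurable (cons_pair @^-1` A).
  by move=> mA; rewrite -[X in measurable X]setTI; exact: measurable_cons_pair.
apply: measure_semi_sigma_additive => [i||].
- exact: mpre.
- apply/trivIsetP => i j _ _ ij; rewrite -preimage_setI.
  by move/trivIsetP : tF => /(_ _ _ _ _ ij) ->//; rewrite preimage_set0.
- by rewrite -preimage_bigcup; exact: mpre.
Qed.

HB.instance Definition _ := isMeasure.Build _ _ _ cons_measure
  cons_measure0 cons_measure_ge0 cons_measure_sigma_additive.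

Let cons_measure_sigma_finite : sigma_finite setT cons_measure.
Proof.
pose l : {sigma_finite_measure set RT -> \bar R} := lebesgue_measure.
have /sigma_finiteP[F [TF ndF Foo]] := sigma_finiteT l.
have /sigma_finiteP[G [TG ndG Goo]] := sigma_finiteT m.
exists (fun i => uncons_pair @^-1` (F i `*` G i)).
  rewrite -preimage_bigcup; apply/esym; rewrite -subTset => t _ /=.
  have [i _ Fi] : (\bigcup_i F i) (uncons_pair t).1 by rewrite -TF.
  have [j _ Gj] : (\bigcup_i G i) (uncons_pair t).2 by rewrite -TG.
  exists (maxn i j) => //; split.
    by move: Fi; exact/subsetPset/ndF/leq_maxl.
  by move: Gj; exact/subsetPset/ndG/leq_maxr.
move=> i; have [mFi Fioo] := Foo i; have [mGi Gioo] := Goo i; split.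
  rewrite -[X in measurable X]setTI.
  by apply: measurable_uncons_pair => //; exact: measurableX.
rewrite /cons_measure /pushforward -comp_preimage.
rewrite (_ : uncons_pair \o cons_pair = id); last first.
  by apply/funext => p; exact: cons_pairK.
by rewrite preimage_id product_measure1E// lte_mul_pinfty// ge0_fin_numE.
Qed.

HB.instance Definition _ := Measure_isSigmaFinite.Build _ _ _ cons_measure
  cons_measure_sigma_finite.

End cons_measure.

Fixpoint lebesgue_tuple k : {sigma_finite_measure set (k.-tuple RT) -> \bar R} :=
  match k with
  | 0 => \d_([tuple] : 0.-tuple RT)
  | k'.+1 => cons_measure (lebesgue_tuple k')
  end.

End lebesgue_tuple.

Section euclidean.
Context {R : realType} {n : nat}.
Implicit Types (u v x : 'cV[R]_n) (f : 'cV[R]_n -> R).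

Definition dotp u v : R := \sum_(i < n) u i 0 * v i 0.

(* The norm `|_| of the library on matrices is the sup norm. *)
Definition enorm u : R := Num.sqrt (dotp u u).

Definition basis_vec (i : 'I_n) : 'cV[R]_n := delta_mx i 0.

Definition last_vec : 'cV[R]_n := \col_(i < n) (i == n.-1 :> nat)%:R.

(* Iterated partial derivative, the last index of the list being applied
   first. A multi-index of order m corresponds to the lists of length m having
   the prescribed multiplicities; by Schwarz's theorem their order is
   irrelevant for C^k functions and derivatives of order at most k. *)
Definition pderivs (s : seq 'I_n) f : 'cV[R]_n -> R :=
  foldr (fun i g => 'D_(basis_vec i) g) f s.

Definition class_C (k : nat) f : Prop :=
  forall s : seq 'I_n, (size s <= k)%N ->
    continuous (pderivs s f) /\
    ((size s < k)%N -> forall i x, derivable (pderivs s f) x (basis_vec i)).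

Definition class_C_decay (k : nat) (mu : R) f : Prop :=
  class_C k f /\
  forall s : seq 'I_n, (size s <= k)%N ->
    exists C M : R, forall x, M <= enorm x ->
      `|pderivs s f x| <= C * enorm x `^ (- mu).

Definition coord_space (k : nat) : {vspace 'cV[R]_n} :=
  (\sum_(i < n | (i < k)%N) <[basis_vec i]>)%VS.

Definition orthonormal_basis k (zeta : {vspace 'cV[R]_n})
    (b : k.-tuple 'cV[R]_n) : Prop :=
  basis_of zeta b /\ forall i j, dotp (tnth b i) (tnth b j) = (i == j)%:R.

(* Integral over a k-dimensional subspace with respect to its Lebesgue measure,
   i.e. the image of Lebesgue measure on R^k under the isometry given by an
   orthonormal basis; the measure does not depend on the chosen basis. *)
Definition subspace_integral k (zeta : {vspace 'cV[R]_n})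
    (g : 'cV[R]_n -> R) : R :=
  let b := xget [tuple of nseq k 0] (@orthonormal_basis k zeta) in
  \int[lebesgue_tuple k]_(y in setT)
    g (\sum_(i < k) (tnth y i : R) *: tnth b i).

Definition plane_rep k (zeta_u : {vspace 'cV[R]_n} * 'cV[R]_n)
    (tau : set 'cV[R]_n) : Prop :=
  [/\ \dim zeta_u.1 = k,
      forall v, v \in zeta_u.1 -> dotp zeta_u.2 v = 0 &
      tau = [set zeta_u.2 + v | v in [set v | v \in zeta_u.1]]].

End euclidean.

Record kplane (R : realType) (n k : nat) := KPlane {
  kplane_set :> set 'cV[R]_n;
  kplaneP : exists zeta_u, plane_rep k zeta_u kplane_set }.

Section kplane_transform.
Context {R : realType} {n k : nat}.
Implicit Types (tau : kplane R n k) (f : 'cV[R]_n -> R).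

(* The (unique) pair (zeta, u) representing tau. *)
Definition kplane_coords tau : {vspace 'cV[R]_n} * 'cV[R]_n :=
  sval (cid (kplaneP tau)).

Definition kplane_transform f tau : R :=
  let: (zeta, u) := kplane_coords tau in
  subspace_integral k zeta (fun v => f (u + v)).

End kplane_transform.

Section special_orthogonal.
Variables (R : realType) (n : nat).

Definition SO_set : set 'M[R]_n := [set g | g^T *m g = 1%:M /\ \det g = 1].

Definition SO : Type := set_type SO_set.

HB.instance Definition _ := Topological.copy SO (set_type SO_set).

Lemma SO_set1 : 1%:M \in SO_set.
Proof. by rewrite inE; split; rewrite ?trmx1 ?mulmx1 ?det1. Qed.

HB.instance Definition _ := isPointed.Build SO (exist _ 1%:M SO_set1).

Definition SO_mx (g : SO) : 'M[R]_n := sval g.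

Lemma SO_mxP (g : SO) : SO_set (SO_mx g).
Proof. by apply: set_mem; exact: (svalP g). Qed.

Lemma SO_mul_subproof (g h : SO) : SO_mx g *m SO_mx h \in SO_set.
Proof.
have [og dg] := SO_mxP g; have [oh dh] := SO_mxP h.
rewrite inE; split; last by rewrite det_mulmx dg dh mulr1.
by rewrite trmx_mul mulmxA -(mulmxA (SO_mx h)^T) og mulmx1.
Qed.

Definition SO_mul (g h : SO) : SO :=
  exist (fun m => m \in SO_set) _ (SO_mul_subproof g h).

Definition SO_borel := g_sigma_algebraType (@open SO).

(* Left-invariant Borel probability measure: by uniqueness (and compactness of
   SO(n)) this characterizes the Haar probability measure. *)
Definition haar_probability (P : probability SO_borel R) : Prop :=
  forall (g : SO) (A : set SO_borel), measurable A ->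
    P [set SO_mul g h | h in A] = P A.

End special_orthogonal.

Section shifted_dual.
Context {R : realType} {n : nat}.
Implicit Types (u v x : 'cV[R]_n).

Definition moved_plane k (g : SO R n) x (r : R) : set 'cV[R]_n :=
  [set SO_mx g *m v + x + r *: (SO_mx g *m last_vec)
     | v in [set v | v \in coord_space k]].

Lemma coord_spaceP k v :
  reflect (forall i : 'I_n, (k <= i)%N -> v i 0 = 0) (v \in coord_space k).
Proof.
apply: (iffP idP) => [/memv_sumP[w ws ->] i ki|v0].
  rewrite summxE big1// => j jk; have /vlineP[c ->] := ws j jk.
  have /negbTE ij : i != j by rewrite -val_eqE/= gtn_eqF// (leq_trans jk).
  by rewrite !mxE ij mulr0.
rewrite (_ : v = \sum_(i < n | (i < k)%N) v i 0 *: basis_vec i).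
  by apply: memv_sumr => i ik; rewrite memvZ// memv_line.
apply/colP => i; rewrite summxE; have [ik|ki] := ltnP i k.
  rewrite (bigD1 i)//= !mxE !eqxx mulr1 big1 ?addr0// => j /andP[_ ji].
  by rewrite !mxE eq_sym (negbTE ji) mulr0.
rewrite v0// big1// => j jk.
have /negbTE ij : i != j by rewrite -val_eqE/= gtn_eqF// (leq_trans jk).
by rewrite !mxE ij mulr0.
Qed.

Lemma dim_coord_space k : (k <= n)%N ->
  \dim (coord_space k : {vspace 'cV[R]_n}) = k.
Proof.
move=> kn; pose J : 'M[R]_(n, k) := pid_mx k.
have JJ : J^T *m J = 1%:M.
  by rewrite tr_pid_mx mul_pid_mx minnn (minn_idPr kn) pid_mx_1.
pose h : 'Hom('cV[R]_k, 'cV[R]_n) := linfun (mulmx J).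
have hE (w : 'cV[R]_k) : h w = J *m w by rewrite lfunE.
have -> : coord_space k = (h @: fullv)%VS.
  apply/vspaceP => v; apply/coord_spaceP/memv_imgP => [v0|[w _ ->] i ki].
    exists (J^T *m v); rewrite ?memvf// hE mulmxA tr_pid_mx mul_pid_mx minnn.
    apply/colP => i; rewrite mxE (bigD1 i)//= big1 ?addr0.
      rewrite !mxE eqxx minnn/=; have [|ki] := ltnP i k; first by rewrite mul1r.
      by rewrite v0// mul0r.
    move=> j ji; rewrite mxE (_ : (i == j :> nat) = false) ?mul0r//.
    by rewrite eq_sym val_eqE (negbTE ji).
  rewrite hE mxE big1// => j _; rewrite mxE.
  by rewrite (gtn_eqF (leq_trans (ltn_ord j) ki)) mul0r.
rewrite limg_dim_eq ?dimvf; first by rewrite /dim/= muln1.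
apply/eqP; rewrite -subv0; apply/subvP => w; rewrite memv_cap => /andP[_].
rewrite memv_ker hE memv0 => /eqP Jw.
by rewrite -[w]mul1mx -JJ -mulmxA Jw mulmx0.
Qed.

Lemma dotp_SO (g : SO R n) u v :
  dotp (SO_mx g *m u) (SO_mx g *m v) = dotp u v.
Proof.
have dotpE (a b : 'cV[R]_n) : dotp a b = (a^T *m b) 0 0.
  by rewrite mxE; apply: eq_bigr => i _; rewrite mxE.
have [og _] := SO_mxP g.
by rewrite !dotpE trmx_mul mulmxA -(mulmxA u^T) og mulmx1.
Qed.

Lemma moved_planeP k (hk : (k <= n)%N) (g : SO R n) x (r : R) :
  exists zeta_u, plane_rep k zeta_u (moved_plane k g x r).
Proof.
have [og _] := SO_mxP g; have go := mulmx1C og.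
set G := SO_mx g.
pose w := G^T *m x + r *: last_vec.
pose w1 := \col_i (if (i < k)%N then w i 0 else 0).
pose w2 := \col_i (if (i < k)%N then 0 else w i 0).
have ww : w = w1 + w2.
  by apply/colP => i; rewrite !mxE; case: ifP; rewrite ?addr0 ?add0r.
have w1k : w1 \in coord_space k.
  by apply/coord_spaceP => i ki; rewrite mxE ltnNge ki.
pose h : 'Hom('cV[R]_n, 'cV[R]_n) := linfun (mulmx G).
have hE v : h v = G *m v by rewrite lfunE.
exists ((h @: coord_space k)%VS, G *m w2); split => /=.
- rewrite limg_dim_eq ?dim_coord_space//; apply/eqP; rewrite -subv0.
  apply/subvP => v; rewrite memv_cap => /andP[_]; rewrite memv_ker hE memv0.
  by move=> /eqP Gv; rewrite -[v]mul1mx -og -mulmxA -/G Gv mulmx0.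
- move=> _ /memv_imgP[v vk ->]; rewrite hE dotp_SO /dotp big1// => i _.
  rewrite mxE; case: ifP => [|/negbT]; rewrite ?mul0r// -leqNgt => ki.
  by move/coord_spaceP : vk => ->//; rewrite mulr0.
- have xE : x + r *: (G *m last_vec) = G *m w2 + G *m w1.
    by rewrite -mulmxDr [w2 + w1]addrC -ww mulmxDr mulmxA go mul1mx scalemxAr.
  apply/seteqP; split => [_ [v vk <-]|_ [_ /memv_imgP[v vk ->] <-]] /=.
    exists (h (w1 + v)); first by rewrite /= memv_img// memvD.
    by rewrite hE mulmxDr -addrA -/G xE addrA addrC.
  exists (v - w1); first by rewrite /= memvB.
  by rewrite hE mulmxBr -addrA -/G xE [G *m w2 + _]addrC addrA addrNK addrC.
Qed.

(* The k-plane gamma R^k + x + r gamma e_n. *)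
Definition rotated_kplane k (hk : (k <= n.-1)%N) (g : SO R n) x (r : R) :
    kplane R n k :=
  KPlane (moved_planeP (leq_trans hk (leq_pred n)) g x r).

Definition shifted_dual k (hk : (k <= n.-1)%N)
    (haar : probability (SO_borel R n) R) (phi : kplane R n k -> R) x (r : R) : R :=
  \int[haar]_(g in setT) phi (rotated_kplane hk g x r).

End shifted_dual.

Section constants.
Variable R : realType.

Definition Gamma (s : R) : R :=
  \int[lebesgue_measure]_(t in `]0, +oo[) (t `^ (s - 1) * expR (- t)).

Definition sphere_area (k : nat) : R :=
  2 * pi `^ (k%:R / 2) / Gamma (k%:R / 2).

Definition inversion_const (k : nat) : R :=
  (-1) ^+ k./2 / ((k.-1)`!%:R * sphere_area k).

Definition neg_deriv (g : R -> R) : R -> R := fun r => - derive1 g r.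

End constants.

(* Main.v *)
(* Fix x and let M(t) be the mean of f over the sphere of radius t about x.
   By Fubini and the invariance of Haar measure, (R*_x R f)(r) is the integral
   of M(sqrt(r^2 + |y|^2)) over y in R^k. For k = 2m, integrating two
   coordinates at a time in polar coordinates turns this into pi^m (J^m g)(r^2)
   with g(s) = M(sqrt s) and (J g)(s) the integral of g over [s, oo[. Hence
   H_p(r) = (J^p g)(r^2) satisfies H_(p+1)' = - 2 r H_p, and Leibniz' rule
   expresses the 2p-th derivative of H_p as
   (-1)^p (2p)!/p! M(r) + O(r), where the error involves only bounds on the
   derivatives of M up to order p, which are uniform in x. *)
From HB Require Import structures.
Require Import Defs.
From mathcomp Require Import all_boot all_order all_algebra.
From mathcomp Require Import all_classical all_reals all_analysis.
From mathcomp Require Import measurable_realfun ring lra.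

Import Order.TTheory GRing.Theory Num.Theory.
Import numFieldNormedType.Exports.
Local Open Scope classical_set_scope.
Local Open Scope ring_scope.
Set Implicit Arguments.
Unset Strict Implicit.
Unset Printing Implicit Defensive.

(** * Lebesgue measure on tuples *)

(** [kplane_transform] takes its pair [(zeta, u)] and its orthonormal basis from choice operators,
    so nothing can be computed before the integral is known to be independent of them; the Euclidean
    invariance of [lebesgue_tuple] serves this purpose. Likewise [haar_probability] gives left
    invariance only, whereas the spherical mean needs right invariance. Both gaps are closed by
    integrating one nonnegative function in two orders, with signed functions split into positive
    and negative parts.

    Radial functions are written in the variable [s = |v|^2]. Decay of order [mu] in [|v|] becomes
    order [nu = mu / 2] in [s], and [mu > k = 2m] says exactly that [nu > m]: each of the [m] tail
    integrals costs one power of decay and requires an exponent above one.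

    Since [g(s) = M(sqrt s)] may fail to be smooth at [0], differentiation in [s] is used only to
    undo a tail integral; all other derivatives fall on [M] or on the explicit factors [r].
    Descending one level in [p] costs two derivatives when a factor [r] is differentiated, and one
    derivative when that factor survives. Only the former terms remain in the limit, and they
    produce the constant. *)

Section translation.
Context {R : realType}.
Notation RT := (measurableTypeR R).
Notation mu := (@lebesgue_measure R).

Lemma measurable_shift (c : R) : measurable_fun [set: RT] (fun x : RT => (x + c : RT)).
Proof. by apply: measurable_funD => //; exact: measurable_cst. Qed.

Lemma lebesgue_measure_shift (c : R) (A : set RT) : measurable A ->
  mu A = pushforward mu (fun x : RT => (x + c : RT)) A.
Proof.
move=> mA.
pose mf := isMeasurableFun.Build _ _ RT RT _ (measurable_shift c).
pose f : {mfun RT >-> RT} := HB.pack (fun x : RT => (x + c : RT)) mf.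
apply: (lebesgue_measure_unique (mu := pushforward mu f)) => // _ [[a b] _ <-] /=.
rewrite /pushforward (_ : _ @^-1` _ = `](a - c), (b - c)]%classic); last first.
  by apply/seteqP; split => x /=; rewrite !in_itv/= lerBrDr ltrBlDr.
by rewrite !lebesgue_measure_itv/= !lte_fin ltrD2r -!EFinB opprB addrA subrK.
Qed.

Lemma ge0_integral_shift (c : R) (h : RT -> \bar R) :
  measurable_fun setT h -> (forall x, 0 <= h x)%E ->
  (\int[mu]_x h (x + c)%R = \int[mu]_x h x)%E.
Proof.
move=> mh h0.
pose mf := isMeasurableFun.Build _ _ RT RT _ (measurable_shift c).
pose f : {mfun RT >-> RT} := HB.pack (fun x : RT => (x + c : RT)) mf.
rewrite [RHS](eq_measure_integral (pushforward mu f)); last first.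
  by move=> A mA _; exact: lebesgue_measure_shift.
by rewrite ge0_integral_pushforward// => y _; exact: h0.
Qed.

End translation.

Section tuple_integral.
Context {R : realType}.
Notation RT := (measurableTypeR R).
Notation mu := (@lebesgue_measure R).

Lemma integral_lebesgue_tupleS k (h : k.+1.-tuple RT -> \bar R) :
  measurable_fun setT h -> (forall x, 0 <= h x)%E ->
  (\int[@lebesgue_tuple R k.+1]_t h t =
   \int[mu]_a \int[@lebesgue_tuple R k]_t h (cons_pair (a, t)))%E.
Proof.
move=> mh h0 /=.
pose mf := isMeasurableFun.Build _ _ _ _ _ (@measurable_cons_pair R k).
pose f : {mfun _ >-> _} := HB.pack (@cons_pair R k) mf.
pose l : {sigma_finite_measure set RT -> \bar R} := mu.
rewrite (eq_measure_integral (pushforward (l \x @lebesgue_tuple R k)%E f))//.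
rewrite ge0_integral_pushforward//.
rewrite preimage_setT fubini_tonelli1//.
  by apply: measurableT_comp => //; exact: measurable_cons_pair.
by move=> p; exact: h0.
Qed.

Lemma integral_lebesgue_tuple0 (h : 0.-tuple RT -> \bar R) :
  (\int[@lebesgue_tuple R 0]_t h t = h [tuple])%E.
Proof.
rewrite /= integral_dirac//; last first.
  move=> _ B mB; rewrite setTI.
  have [|h0] := pselect (B (h [tuple])).
    by move=> ?; rewrite (_ : _ @^-1` _ = setT)//; apply/seteqP; split => // t _ /=; rewrite tuple0.
  rewrite (_ : _ @^-1` _ = set0)//; apply/seteqP; split => // t /=; rewrite tuple0//.
by rewrite diracT mul1e.
Qed.

Lemma tnth_cons_pair0 k (p : RT * k.-tuple RT) : tnth (cons_pair p) ord0 = p.1.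
Proof. by rewrite tnth0. Qed.

Lemma tnth_cons_pairS k (p : RT * k.-tuple RT) (i : 'I_k) :
  tnth (cons_pair p) (lift ord0 i) = tnth p.2 i.
Proof. exact: tnthS. Qed.

Definition tuple_shift k (c t : k.-tuple RT) : k.-tuple RT :=
  [tuple (tnth t i + tnth c i : R) | i < k].

Lemma ge0_integral_tuple_shift k (c : k.-tuple RT) (h : k.-tuple RT -> \bar R) :
  measurable_fun setT h -> (forall x, 0 <= h x)%E ->
  (\int[@lebesgue_tuple R k]_t h (tuple_shift c t) =
   \int[@lebesgue_tuple R k]_t h t)%E.
Proof.
elim: k c h => [c h mh h0|k IH c h mh h0].
  by rewrite !integral_lebesgue_tuple0; congr h; apply: eq_from_tnth => -[].
rewrite !integral_lebesgue_tupleS//; last first.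
  apply: measurableT_comp => //; apply/measurable_fun_tnthP => i.
  rewrite (_ : _ \o _ = fun t : k.+1.-tuple RT => (tnth t i + tnth c i : R)).
    apply: measurable_funD; last exact: measurable_cst.
    exact: measurable_tnth.
  by apply/funext => t /=; rewrite tnth_mktuple.
have mcons a : measurable_fun setT (fun t => h (cons_pair (a, t))).
  apply: measurableT_comp => //; apply: measurableT_comp; first exact: measurable_cons_pair.
  exact: pair1_measurable.
rewrite -[RHS](ge0_integral_shift (tnth c ord0)); last 2 first.
- have mhc : measurable_fun setT (h \o @cons_pair R k).
    by apply: measurableT_comp => //; exact: measurable_cons_pair.
  have h0c p : (0 <= (h \o @cons_pair R k) p)%E by exact: h0.
  have := (measurable_fun_fubini_tonelli_F (m2 := lebesgue_tuple k) _ mhc h0c).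
  by [].
- by move=> x; apply: integral_ge0.
apply: eq_integral => a _.
rewrite -(IH [tuple tnth c (lift ord0 i) | i < k]
  (fun t => h (cons_pair ((a + tnth c ord0)%R, t))))//.
apply: eq_integral => t _; congr h; apply: eq_from_tnth => i.
rewrite tnth_mktuple; case: (unliftP ord0 i) => [j ->|->].
  by rewrite !tnth_cons_pairS !tnth_mktuple.
by rewrite !tnth_cons_pair0.
Qed.

End tuple_integral.

(** * Radial integrals and the tail integral operator *)

Section radial2.
Context {R : realType}.
Notation RT := (measurableTypeR R).
Notation mu := (@lebesgue_measure R).

Lemma set_ge0_itv : [set x : R | 0 <= x] = `[0, +oo[%classic.
Proof. by apply/seteqP; split => x /=; rewrite in_itv/= andbT. Qed.

Lemma ge0_integral_scale (c : R) (H : R -> R) : 0 < c -> continuous H ->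
  (forall x, 0 <= H x) ->
  (\int[mu]_(x in `[0%R, +oo[) (H x)%:E =
   \int[mu]_(x in `[0%R, +oo[) (c * H (c * x))%:E)%E.
Proof.
move=> c0 cH H0.
have dF (x : R) : is_derive x (1 : R) ( *%R c) c.
  have : is_derive x (1:R) (c *: (id : R -> R)) (c *: (1 : R)).
    exact: is_deriveZ.
  by rewrite /GRing.scale/= mulr1.
have dFE : derive1 ( *%R c) = cst c.
  by apply/funext => x; rewrite derive1E derive_val.
have := @increasing_ge0_integration_by_substitutiony R ( *%R c) H 0.
rewrite mulr0 dFE => ->.
- by apply: eq_integral => x _ /=; rewrite mulrC.
- by move=> x y _ _ xy; rewrite ltr_pM2l.
- by move=> x _; exact: cst_continuous.
- exact: is_cvg_cst.
- exact: is_cvg_cst.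
- split; first by move=> x _; apply: ex_derive.
  apply: cvg_at_right_filter; apply: cvgMl_tmp; exact: cvg_id.
- exact: gt0_cvgMry.
- exact: continuous_subspaceT.
- by move=> x _.
Qed.

Lemma ge0_even_integral_scale (c : R) (H : R -> R) : 0 < c -> continuous H ->
  (forall x, 0 <= H x) -> (forall x, H (- x) = H x) ->
  (\int[mu]_x (H x)%:E = \int[mu]_x (c * H (c * x))%:E)%E.
Proof.
move=> c0 cH H0 eH.
rewrite ge0_symfun_integralT//; last by move=> x /=; rewrite eH.
rewrite [RHS]ge0_symfun_integralT//.
- by rewrite set_ge0_itv (ge0_integral_scale c0).
- by move=> x; rewrite mulr_ge0// ltW.
- move=> x; apply: cvgMl_tmp; apply: (@continuous_comp _ _ _ ( *%R c) H); last exact: cH.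
  exact: mulrl_continuous.
- by move=> x /=; rewrite mulrN eH.
Qed.

(** The source of the factor [pi] in the radial integrals: [x] plays the tangent [b / |a|] of the
    polar angle. *)
Lemma integral_oneDsqrV : (\int[mu]_x ((1 + x ^+ 2)^-1)%:E = (pi : R)%:E)%E.
Proof.
have p0 (x : R) : 0 < 1 + x ^+ 2 by rewrite ltr_pwDl// sqr_ge0.
have cf : continuous (fun x : R => (1 + x ^+ 2)^-1).
  move=> x; apply: cvgV; first by rewrite gt_eqF.
  by apply: cvgD; [exact: cvg_cst|exact: exprn_continuous].
rewrite ge0_symfun_integralT//; last 2 first.
- by move=> x; rewrite invr_ge0 ltW.
- by move=> x /=; rewrite sqrrN.
rewrite set_ge0_itv (@ge0_continuous_FTC2y _ _ atan _ (pi / 2)).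
- by rewrite atan0 sube0 -EFinM; congr EFin; field.
- by move=> x _; rewrite invr_ge0 ltW.
- exact: continuous_subspaceT.
- exact: cvgy_atan.
- by move=> x _; exact: ex_derive.
- by apply: cvg_at_right_filter; exact: continuous_atan.
- by move=> x _; rewrite derive1_atan.
Qed.

(* The substitution rule on a half-line requires a convergent derivative, which
   fails for a^2 c; so it is used on segments, followed by a limit. *)
Lemma ge0_integral_sqr_scale (c : R) (G : R -> R) : 0 < c -> continuous G ->
  (forall x, 0 <= G x) ->
  (\int[mu]_a (`|a| * G (a ^+ 2 * c))%:E =
   (c^-1)%:E * \int[mu]_(u in `[0%R, +oo[) (G u)%:E)%E.
Proof.
move=> c0 cG G0.
have cs : continuous (fun a : R => a ^+ 2 * c).
  by move=> x; apply: cvgMr_tmp; exact: exprn_continuous.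
have cGs : continuous (fun a : R => G (a ^+ 2 * c)).
  by move=> x; apply: (@continuous_comp _ _ _ (fun a : R => a ^+ 2 * c) G); [exact: cs|exact: cG].
rewrite ge0_symfun_integralT; last 3 first.
- by move=> x; rewrite mulr_ge0.
- by move=> x; apply: cvgM; [exact: norm_continuous|exact: cGs].
- by move=> x /=; rewrite normrN sqrrN.
have dF (x : R) : is_derive x (1 : R) (fun a : R => a ^+ 2 * c) (2 * x * c).
  have -> : (fun a : R => a ^+ 2 * c) = (c *: (id ^+ 2)).
    by apply/funext => a /=; rewrite /GRing.scale/= mulrC.
  apply: is_derive_eq; rewrite /GRing.scale/= expr1 mulr1 /id; ring.
have dFE : derive1 (fun a : R => a ^+ 2 * c) = fun x => 2 * x * c.
  by apply/funext => x; rewrite derive1E derive_val.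

rewrite set_ge0_itv itv0y_bigcup0S.
pose S n : set R := `[0, n.+1%:R]%classic.
have ndS : nondecreasing_seq S.
  move=> p q pq; apply/subsetPset => x; rewrite /S/= !in_itv/= => /andP[-> /le_trans]; apply.
  by rewrite ler_nat ltnS.
pose S' n : set R := `[0, n.+1%:R ^+ 2 * c]%classic.
have ndS' : nondecreasing_seq S'.
  move=> p q pq; apply/subsetPset => x; rewrite /S'/= !in_itv/= => /andP[-> /le_trans]; apply.
  by rewrite ler_pM2r// ler_pXn2r ?nnegrE// ler_nat ltnS.
have S'E : \bigcup_i S' i = `[0, +oo[%classic.
  apply/seteqP; split => x /=.
    by move=> [n _]; rewrite /S'/= !in_itv/= => /andP[->].
  rewrite in_itv/= andbT => x0; exists (Num.truncn (x / c)) => //.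
  rewrite /S'/= in_itv/= x0/= -ler_pdivrMr//.
  rewrite (le_trans (ltW (truncnS_gt _)))// expr2 ler_peMl// ler1n//.
have mGs D : measurable_fun D (fun x : R => (`|x| * G (x ^+ 2 * c))%:E).
  apply/measurable_funTS/measurable_EFinP; apply: measurable_funM; first exact: normr_measurable.
  exact: continuous_measurable_fun.
have sub n : (\int[mu]_(x in S' n) (G x)%:E =
    (2 * c)%:E * \int[mu]_(x in S n) (`|x| * G (x ^+ 2 * c))%:E)%E.
  have := @integration_by_substitution_increasing R (fun a => a ^+ 2 * c) G 0 n.+1%:R.
  have cdF : continuous (fun x : R => 2 * x * c).
    by move=> x; apply: cvgMr_tmp; apply: cvgMl_tmp; exact: cvg_id.
  rewrite expr0n/= mul0r dFE => ->.
  - rewrite -ge0_integralZl_EFin//=; first last.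
    + by rewrite mulr_ge0// ltW.
    + exact: mGs.
    + by move=> x _; rewrite lee_fin mulr_ge0.
    + exact: measurable_itv.
    apply: eq_integral => x; rewrite inE/= in_itv/= => /andP[x0 _].
    rewrite ger0_norm// -EFinM; congr EFin.
    transitivity (G (x ^+ 2 * c) * (2 * x * c)) => //; ring.
  - by [].
  - move=> x y; rewrite !in_itv/= => /andP[x0 _] /andP[y0 _] xy.
    by rewrite ltr_pM2r// ltr_pXn2r ?nnegrE.
  - by move=> x _; exact: cdF.
  - by apply: cvgP; apply: cvg_at_right_filter; exact: cdF.
  - by apply: cvgP; apply: cvg_at_left_filter; exact: cdF.
  - split; first by move=> x _; exact: ex_derive.
    + by apply: cvg_at_right_filter; exact: cs.
    + by apply: cvg_at_left_filter; exact: cs.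
  - exact: continuous_subspaceT.
have cvL : (\int[mu]_(x in S n) (`|x| * G (x ^+ 2 * c))%:E)%E @[n --> \oo] -->
    (\int[mu]_(x in \bigcup_i S i) (`|x| * G (x ^+ 2 * c))%:E)%E.
  apply: ge0_nondecreasing_set_cvg_integral => //.
    by move=> n; exact: measurable_itv.
    by move=> n; exact: mGs.
  by move=> n x _; rewrite lee_fin mulr_ge0.
have cvR : (\int[mu]_(x in S' n) (G x)%:E)%E @[n --> \oo] -->
    (\int[mu]_(x in \bigcup_i S' i) (G x)%:E)%E.
  apply: ge0_nondecreasing_set_cvg_integral => //.
    by move=> n; exact: measurable_itv.
    by move=> n; apply/measurable_funTS/measurable_EFinP; exact: continuous_measurable_fun.
  by move=> n x _; rewrite lee_fin.
rewrite -[in RHS]itv0y_bigcup0S -S'E.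
have -> : (\int[mu]_(x in \bigcup_i S' i) (G x)%:E =
    (2 * c)%:E * \int[mu]_(x in \bigcup_i S i) (`|x| * G (x ^+ 2 * c))%:E)%E.
  rewrite (eq_cvg _ _ sub) in cvR.
  apply: (cvg_unique _ cvR) => //.
  exact: cvgeZl.
rewrite muleA -EFinM (_ : c^-1 * (2 * c) = 2)//.
by field; rewrite gt_eqF.
Qed.

(* Polar coordinates without angles: substitute b = |a| c, exchange the
   integrals, and substitute u = a^2 (1 + c^2). *)
Lemma ge0_radial_integral2 (G : R -> R) : continuous G -> (forall x, 0 <= G x) ->
  (\int[mu]_a \int[mu]_b (G (a ^+ 2 + b ^+ 2))%:E =
   (pi : R)%:E * \int[mu]_(u in `[0%R, +oo[) (G u)%:E)%E.
Proof.
move=> cG G0.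
have mG : measurable_fun setT G by exact: continuous_measurable_fun.
pose l : {sigma_finite_measure set RT -> \bar R} := mu.
pose K (p : RT * RT) : R := `|p.1| * G (p.1 ^+ 2 * (1 + p.2 ^+ 2)).
have K0 p : 0 <= K p by rewrite mulr_ge0.
have mK : measurable_fun setT (EFin \o K).
  apply/measurable_EFinP; apply: measurable_funM.
    by apply: measurableT_comp => //.
  apply: measurableT_comp => //; apply: measurable_funM.
    exact: measurable_funX.
  by apply: measurable_funD => //; exact: measurable_funX.
have cGa (a : R) : continuous (fun b : R => G (a ^+ 2 + b ^+ 2)).
  move=> b; apply: (@continuous_comp _ _ _ (fun b : R => a ^+ 2 + b ^+ 2) G); last exact: cG.
  by apply: cvgD; [exact: cvg_cst|exact: exprn_continuous].
have mG2 : measurable_fun setT (fun p : RT * RT => (G (p.1 ^+ 2 + p.2 ^+ 2))%:E).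
  apply/measurable_EFinP/measurableT_comp => //.
  by apply: measurable_funD; exact: measurable_funX.
transitivity (\int[mu]_a \int[mu]_c (K (a, c))%:E)%E.
  apply: ge0_ae_eq_integral => //.
  - have G20 (p : RT * RT) : (0 <= (G (p.1 ^+ 2 + p.2 ^+ 2))%:E)%E by rewrite lee_fin.
    have := measurable_fun_fubini_tonelli_F (m2 := l) _ mG2 G20.
    exact.
  - have := measurable_fun_fubini_tonelli_F (m2 := l) _ mK K0.
    exact.
  - by move=> x _; apply: integral_ge0 => y _; rewrite lee_fin.
  - by move=> x _; apply: integral_ge0 => y _; rewrite lee_fin.
  - exists [set 0]; split => //; first exact: lebesgue_measure_set1.
    move=> a /= na; apply: contrapT => /eqP a0; apply: na => _.
    have a0' : 0 < `|a| by rewrite normr_gt0.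
    rewrite (ge0_even_integral_scale a0')//.
      apply: eq_integral => c _; rewrite /K/=; congr (_ * G _)%:E.
      by rewrite exprMn real_normK ?num_real// mulrDr mulr1.
    by move=> x; rewrite sqrrN.
rewrite (fubini_tonelli (m1 := l) (m2 := l) (EFin \o K))//=.
rewrite -integral_oneDsqrV -ge0_integralZr//; last 3 first.
- apply/measurable_EFinP; apply: continuous_measurable_fun => x.
  apply: cvgV; first by rewrite gt_eqF// ltr_pwDl// sqr_ge0.
  by apply: cvgD; [exact: cvg_cst|exact: exprn_continuous].
- by move=> x _; rewrite lee_fin invr_ge0 addr_ge0// sqr_ge0.
- by apply: integral_ge0 => x _; rewrite lee_fin.
apply: eq_integral => c _; rewrite /K/=.
by rewrite ge0_integral_sqr_scale// ltr_pwDl// sqr_ge0.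
Qed.

Definition tail_integral (g : R -> R) (s : R) : R := \int[mu]_(u in `[s, +oo[) g u.

(* Values at negative arguments are irrelevant, but continuity there avoids
   one-sided derivatives at 0. *)
Definition tail_decay (nu : R) (g : R -> R) : Prop :=
  continuous g /\ exists C, forall s, 0 <= s -> `|g s| <= C * (1 + s) `^ (- nu).

Lemma ge0_radial_integral2_shift (g : R -> R) (s : R) : continuous g -> (forall x, 0 <= g x) ->
  (\int[mu]_a \int[mu]_b (g (s + a ^+ 2 + b ^+ 2))%:E =
   (pi : R)%:E * \int[mu]_(u in `[s, +oo[) (g u)%:E)%E.
Proof.
move=> cg g0.
have -> : (\int[mu]_(u in `[s, +oo[) (g u)%:E = \int[mu]_(u in `[0%R, +oo[) (g (u + s))%:E)%E.
  rewrite integral_mkcond [RHS]integral_mkcond.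
  rewrite -[LHS](ge0_integral_shift s).
  - apply: eq_integral => x _; rewrite !patchE.
    by rewrite !mem_setE !in_itv/= !andbT lerDr.
  - apply/(measurable_restrictT _ _).1 => //.
    by apply/measurable_funTS/measurable_EFinP; exact: continuous_measurable_fun.
  - by move=> x; rewrite patchE; case: ifPn => // _; rewrite lee_fin.
rewrite -(ge0_radial_integral2 (G := fun u => g (u + s)))//.
  by apply: eq_integral => a _; apply: eq_integral => b _; rewrite -addrA addrC.
move=> x; apply: (@continuous_comp _ _ _ (fun u : R => u + s) g); last exact: cg.
by apply: cvgD; [exact: cvg_id|exact: cvg_cst].
Qed.

Lemma cvgy_powRN (p : R) : 0 < p -> (1 + u) `^ (- p) @[u --> +oo] --> (0 : R).
Proof.
move=> p0; apply/cvgrPdist_lt => e e0; near=> u.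
rewrite sub0r normrN ger0_norm ?powR_ge0// powRN.
rewrite invf_plt ?posrE//; last by rewrite powR_gt0// ltr_pwDl.
have -> : e^-1 = (e^-1 `^ p^-1) `^ p.
  by rewrite -powRrM mulVf ?gt_eqF// powRr1// invr_ge0 ltW.
apply: gt0_ltr_powR => //; rewrite ?nnegrE ?powR_ge0 ?addr_ge0//.
have : e^-1 `^ p^-1 < u by near: u; exact: nbhs_pinfty_gt.
by move=> /lt_le_trans; apply; rewrite lerDr.
Unshelve. all: by end_near. Qed.

Lemma integral_powR_tail (nu s : R) : 1 < nu -> 0 <= s ->
  (\int[mu]_(u in `[s, +oo[) ((1 + u) `^ (- nu))%:E =
   ((nu - 1)^-1 * (1 + s) `^ (- (nu - 1)))%:E)%E.
Proof.
move=> nu1 s0; have nu10 : 0 < nu - 1 by rewrite subr_gt0.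
pose F (u : R) := - (nu - 1)^-1 * (1 + u) `^ (- (nu - 1)).
have d1 (x : R) : is_derive x (1 : R) (fun u : R => 1 + u) 1.
  rewrite (_ : (fun u : R => 1 + u) = cst (1 : R) + id)//.
  by apply: is_derive_eq; rewrite add0r.
have dpow (q x : R) : 0 <= x ->
    is_derive x (1 : R) (fun u : R => (1 + u) `^ q) (q * (1 + x) `^ (q - 1)).
  move=> x0; rewrite -[X in is_derive _ _ _ X]mulr1.
  apply: (@is_derive1_comp _ (@powR R ^~ q) (fun u => 1 + u)).
  by apply: is_derive1_powR; rewrite ltr_pwDl.
have dF (x : R) : 0 <= x -> is_derive x (1 : R) F ((1 + x) `^ (- nu)).
  move=> x0; have H := dpow (- (nu - 1)) x x0.
  have -> : F = (- (nu - 1)^-1) *: (fun u : R => (1 + u) `^ (- (nu - 1))) by [].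
  apply: is_derive_eq; rewrite /GRing.scale/=.
  rewrite mulrA mulrNN mulVf ?gt_eqF// mul1r; congr (_ `^ _); ring.
rewrite (@ge0_continuous_FTC2y _ _ F _ 0).
- by rewrite sub0e -EFinN; congr EFin; rewrite /F mulNr opprK.
- by move=> x _; exact: powR_ge0.
- apply: derivable_within_continuous => x; rewrite in_itv/= andbT => sx.
  by apply: ex_derive; apply: dpow; rewrite (le_trans s0).
- rewrite -(mulr0 (- (nu - 1)^-1)); apply: cvgMl_tmp; exact: cvgy_powRN.
- by move=> x sx; apply: ex_derive; apply: dF; rewrite (le_trans s0)// ltW.
- apply: cvg_at_right_filter; apply: differentiable_continuous; apply/derivable1_diffP.
  by apply: ex_derive; exact: dF.
- move=> x; rewrite in_itv/= andbT => sx; rewrite derive1E.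
  by have H := dF x (le_trans s0 (ltW sx)); rewrite derive_val.
Qed.

Lemma integrable_powR_tail (nu C s : R) : 1 < nu -> 0 <= s ->
  mu.-integrable `[s, +oo[ (fun u => (C * (1 + u) `^ (- nu))%:E).
Proof.
move=> nu1 s0.
suff H : mu.-integrable `[s, +oo[ (fun u => ((1 + u) `^ (- nu))%:E).
  rewrite (_ : (fun u => (C * _)%:E) = (fun u => C%:E * ((1 + u) `^ (- nu))%:E)%E)//.
  exact: integrableZl.
apply/integrableP; split.
  apply/measurable_funTS/measurable_EFinP.
  apply: (measurableT_comp (f := @powR R ^~ (- nu))); first exact: measurable_powR.
  exact: measurable_funD.
under eq_integral do rewrite gee0_abs ?lee_fin ?powR_ge0//.
by rewrite integral_powR_tail// ltry.
Qed.

(** The decay bound holds only on [[0, +oo[]; for negative [s] the remaining segment [[s, 0]] is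
    compact and continuity suffices there. *)
Lemma tail_decay_integrable (nu : R) (g : R -> R) (s : R) : 1 < nu -> tail_decay nu g ->
  mu.-integrable `[s, +oo[ (EFin \o g).
Proof.
move=> nu1 [cg [C gC]].
have mg : measurable_fun setT g by exact: continuous_measurable_fun.
have i0 : mu.-integrable `[0, +oo[ (EFin \o g).
  have ip := integrable_powR_tail C nu1 (lexx 0).
  apply: le_integrable ip => //; first exact/measurable_funTS/measurable_EFinP.
  move=> x; rewrite /= in_itv/= andbT => x0; rewrite lee_fin.
  by rewrite (le_trans (gC _ x0))// ler_norm.
have [s0|s0] := leP 0 s.
  apply: integrableS i0 => //; apply: subset_itvr; rewrite bnd_simp//.
have -> : `[s, +oo[%classic = `[s, 0] `|` `]0, +oo[ :> set R.
  apply/seteqP; split => x /=; rewrite !in_itv/= !andbT.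
    by move=> ->; have [x0|x0] := ltP 0 x; [right|left].
  by move=> [/andP[]//|/ltW]; apply: le_trans; exact: ltW.
have /integrableP[_ i1] : mu.-integrable `[s, 0] (EFin \o g).
  apply: continuous_compact_integrable; first exact: segment_compact.
  exact: continuous_subspaceT.
have /integrableP[_ i2] : mu.-integrable `]0, +oo[ (EFin \o g).
  by apply: integrableS i0 => //; apply: subset_itvr; rewrite bnd_simp.
apply/integrableP; split; first exact/measurable_funTS/measurable_EFinP.
rewrite ge0_integral_setU//=.
- exact: lte_add_pinfty.
- by apply/measurable_funTS/measurable_EFinP; exact: measurableT_comp.
- apply/disj_setPS => x /= []; rewrite !in_itv/= andbT => /andP[_ x0].
  by rewrite ltNge x0.
Qed.

(** To the right of [a = s - 1], the tail integral is a constant minus the primitive based at [a],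
    so the fundamental theorem of calculus applies at the interior point [s]. *)
Lemma tail_integral_derive (nu : R) (g : R -> R) (s : R) : 1 < nu -> tail_decay nu g ->
  is_derive s (1 : R) (tail_integral g) (- g s).
Proof.
move=> nu1 gd; have [cg _] := gd.
pose a := s - 1.
have ig t := tail_decay_integrable t nu1 gd.
have iga t : mu.-integrable `[a, t] (EFin \o g).
  apply: continuous_compact_integrable; first exact: segment_compact.
  exact: continuous_subspaceT.
have [] := @continuous_FTC1_closed R g a s (s + 1) _ (iga _) _ (cg s).
- by rewrite ltrDl.
- by rewrite ltrBlDr ltrDl.
set G := fun x => _ => dG GE.
have JE t : a < t -> tail_integral g t = tail_integral g a - G t.
  move=> at_; rewrite /G /tail_integral (Rintegral_itvB (ig a)) ?bnd_simp ?(ltW at_)//.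
  rewrite Rintegral_itv_obnd_cbnd//; apply: integrableS (ig t) => //.
  by apply: subset_itvr; rewrite bnd_simp.
have H : is_derive s (1 : R) (cst (tail_integral g a) - G) (- g s).
  have dGs : is_derive s (1 : R) G (g s).
    by apply: DeriveDef; [exact: dG|rewrite -derive1E].
  by apply: is_derive_eq; rewrite sub0r.
apply: near_eq_is_derive H.
near=> t; rewrite [RHS]JE//; near: t; apply: lt_nbhsr; rewrite /a ltrBlDr ltrDl//.
Unshelve. all: by end_near. Qed.

(** One integration costs one power of decay; this fixes how often [tail_integral] can be
    iterated. *)
Lemma tail_decay_integral (nu : R) (g : R -> R) : 1 < nu -> tail_decay nu g ->
  tail_decay (nu - 1) (tail_integral g).
Proof.
move=> nu1 gd; have [cg [C gC]] := gd; split.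
  move=> s; apply: differentiable_continuous; apply/derivable1_diffP.
  by have H := tail_integral_derive s nu1 gd; exact: ex_derive.
exists (C * (nu - 1)^-1) => s s0.
have ig := tail_decay_integrable s nu1 gd.
rewrite (le_trans (le_normr_Rintegral _ _))// -lee_fin.
rewrite fineK; last by apply: integrable_fin_num => //; exact: integrable_norm ig.
apply: (@le_trans _ _ (\int[mu]_(u in `[s, +oo[) (C * (1 + u) `^ (- nu))%:E)%E).
  apply: le_integral => //.
  - exact: integrable_norm ig.
  - exact: integrable_powR_tail.
  - move=> u; rewrite inE/= in_itv/= andbT => su; rewrite lee_fin gC//.
    exact: le_trans su.
under eq_integral do rewrite EFinM.
have ip : mu.-integrable `[s, +oo[ (fun u => ((1 + u) `^ (- nu))%:E).
  have := integrable_powR_tail 1 nu1 s0.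
  by under [X in mu.-integrable _ X]eq_fun do rewrite mul1r.
by rewrite integralZl// integral_powR_tail// -EFinM lee_fin mulrA.
Qed.

Lemma tail_integral_ge0 (g : R -> R) : (forall x, 0 <= g x) -> forall x, 0 <= tail_integral g x.
Proof. by move=> g0 x; apply: Rintegral_ge0. Qed.

Lemma EFin_tail_integral (nu : R) (g : R -> R) s : 1 < nu -> tail_decay nu g ->
  ((tail_integral g s)%:E = \int[mu]_(u in `[s, +oo[) (g u)%:E)%E.
Proof.
move=> nu1 gd; rewrite fineK//; apply: integrable_fin_num => //.
exact: (tail_decay_integrable s nu1 gd).
Qed.

Definition sqnorm_tuple k (t : k.-tuple RT) : R := \sum_(i < k) (tnth t i : R) ^+ 2.

Lemma measurable_sqnorm_tuple k : measurable_fun setT (@sqnorm_tuple k).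
Proof.
apply: measurable_sum => i; apply: measurable_funX; exact: measurable_tnth.
Qed.

Lemma sqnorm_tuple_ge0 k (t : k.-tuple RT) : 0 <= sqnorm_tuple t.
Proof. by apply: sumr_ge0 => i _; rewrite sqr_ge0. Qed.

Lemma sqnorm_tuple_cons k a (t : k.-tuple RT) :
  sqnorm_tuple (cons_pair (a, t)) = a ^+ 2 + sqnorm_tuple t.
Proof.
rewrite /sqnorm_tuple big_ord_recl tnth_cons_pair0; congr (_ + _).
by apply: eq_bigr => i _; rewrite tnth_cons_pairS.
Qed.

Lemma tail_decay_iter (nu : R) (g : R -> R) m : m%:R < nu -> tail_decay nu g ->
  tail_decay (nu - m%:R) (iter m tail_integral g).
Proof.
elim: m => [|m IH] mnu gd /=; first by rewrite subr0.
rewrite -natr1 opprD addrA; apply: tail_decay_integral.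
  by rewrite ltrBrDr addrC natr1.
by apply: IH => //; apply: lt_trans mnu; rewrite ltr_nat.
Qed.

(** The free shift [s] closes the induction: the squares of the two coordinates peeled off are
    absorbed into it, and [ge0_radial_integral2_shift] then trades them for a factor [pi] and one
    more tail integral. *)
Lemma ge0_integral_radial (m : nat) (nu : R) (g : R -> R) s : m%:R < nu ->
  tail_decay nu g -> (forall x, 0 <= g x) -> 0 <= s ->
  (\int[@lebesgue_tuple R m.*2]_t (g (s + sqnorm_tuple t))%:E =
   (pi ^+ m * iter m tail_integral g s)%:E)%E.
Proof.
move=> + gd g0; have [cg _] := gd.
have mg : measurable_fun setT g by exact: continuous_measurable_fun.
elim: m s => [|m IH] s mnu s0.
  rewrite integral_lebesgue_tuple0 expr0 mul1r /= /sqnorm_tuple big_ord0 addr0//.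
have mh k c : measurable_fun setT (fun t : k.-tuple RT => (g (c + sqnorm_tuple t))%:E).
  apply/measurable_EFinP; apply: measurableT_comp => //.
  by apply: measurable_funD => //; exact: measurable_sqnorm_tuple.
have mnu' : m%:R < nu by apply: lt_trans mnu; rewrite ltr_nat.
have gdm := tail_decay_iter mnu' gd.
have gm0 x : 0 <= iter m tail_integral g x.
  by elim: (m) x => //= p ih x; apply: tail_integral_ge0.
rewrite doubleS integral_lebesgue_tupleS//; last by move=> t; rewrite lee_fin.
transitivity (\int[mu]_a \int[mu]_b (pi ^+ m * iter m tail_integral g (s + a ^+ 2 + b ^+ 2))%:E)%E.
  apply: eq_integral => a _.
  under eq_integral do rewrite sqnorm_tuple_cons addrA.
  rewrite integral_lebesgue_tupleS//; last by move=> t; rewrite lee_fin.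
  apply: eq_integral => b _.
  under eq_integral do rewrite sqnorm_tuple_cons addrA.
  by rewrite IH// !addr_ge0// sqr_ge0.
rewrite (ge0_radial_integral2_shift
  (g := fun u => pi ^+ m * iter m tail_integral g u)); last 2 first.
- by move=> x; apply: cvgMl_tmp; apply: gdm.1.
- by move=> x; rewrite mulr_ge0// exprn_ge0// pi_ge0.
have numm : 1 < nu - m%:R by rewrite ltrBrDr addrC natr1.
under eq_integral do rewrite EFinM.
rewrite integralZl//; last exact: tail_decay_integrable gdm.
by rewrite -(EFin_tail_integral s numm gdm) -!EFinM exprS mulrA.
Qed.

End radial2.

(** * Continuous functions are measurable; orthonormal frames *)

Section continuous_measurable.
Context {R : realType} {d : measure_display} {T : measurableType d} {n : nat}.

(* An open set of R^n is the countable union of the rational boxes it contains. *)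
Lemma measurable_preimage_open (phi : T -> 'cV[R]_n) (V : set 'cV[R]_n) :
  (forall i, measurable_fun setT (fun t => phi t i 0)) -> open V ->
  measurable (phi @^-1` V).
Proof.
move=> mphi oV.
pose box (q : 'cV[rat]_n * 'cV[rat]_n) : set 'cV[R]_n :=
  [set v | forall i, ratr (q.1 i 0) < v i 0 < ratr (q.2 i 0)].
have -> : V = \bigcup_q (if `[< box q `<=` V >] then box q else set0).
  apply/seteqP; split => v; last first.
    by move=> [q _]; case: ifPn => // /asboolP; apply.
  move=> Vv; have /nbhs_ballP[e /= e0 eV] := open_nbhs_nbhs (conj oV Vv).
  have /choice[q1 hq1] (i : 'I_n) : exists q : rat, v i 0 - e < ratr q < v i 0.
    have /rat_in_itvoo[q] : v i 0 - e < v i 0 by rewrite ltrBlDr ltrDl.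
    by rewrite in_itv/=; exists q.
  have /choice[q2 hq2] (i : 'I_n) : exists q : rat, v i 0 < ratr q < v i 0 + e.
    have /rat_in_itvoo[q] : v i 0 < v i 0 + e by rewrite ltrDl.
    by rewrite in_itv/=; exists q.
  exists (\col_i q1 i, \col_i q2 i) => //.
  rewrite asboolT.
    by move=> i /=; rewrite !mxE; have /andP[_ ->] := hq1 i; have /andP[->] := hq2 i.
  move=> w bw; apply: eV; split => // i j; rewrite ord1.
  have /= := bw i; rewrite !mxE => /andP[wl wr].
  have /andP[l1 _] := hq1 i; have /andP[_ r1] := hq2 i.
  rewrite /ball/= distrC ltr_distl (lt_trans l1 wl)/=.
  exact: lt_trans r1.
rewrite preimage_bigcup; apply: countable_bigcupT_measurable => // q.
case: ifPn => _; last by rewrite preimage_set0.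
have -> : phi @^-1` box q = \big[setI/setT]_(i < n)
    ((fun t => phi t i 0) @^-1` `]ratr (q.1 i 0), ratr (q.2 i 0)[%classic).
  apply/seteqP; split => t /=.
    by move=> h; rewrite -bigcap_seq => i _ /=; rewrite in_itv/=; apply: h.
  rewrite -bigcap_seq => h i; have := h i; rewrite /= in_itv/=; apply.
  by rewrite mem_index_enum.
apply: bigsetI_measurable => i _; rewrite -[X in measurable X]setTI.
by apply: mphi => //; exact: measurable_itv.
Qed.

(** Measurability of a map into ['cV[R]_n] is phrased coordinate by coordinate here and below;
    continuity of [F] is the bridge back to real-valued functions. *)
Lemma measurable_continuous_comp (F : 'cV[R]_n -> R) (phi : T -> 'cV[R]_n) :
  continuous F -> (forall i, measurable_fun setT (fun t => phi t i 0)) ->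
  measurable_fun setT (F \o phi).
Proof.
move=> cF mphi; apply: (measurability _ (RGenOpens.measurableE R)).
move=> _ [_ [a [b ->] <-]]; rewrite setTI.
rewrite comp_preimage; apply: measurable_preimage_open => //.
by move/continuousP : cF; apply; exact: interval_open.
Qed.

End continuous_measurable.

Section isometry.
Context {R : realType} {n : nat}.
Notation RT := (measurableTypeR R).
Implicit Types (u v w : 'cV[R]_n).

Lemma dotpC u v : dotp u v = dotp v u.
Proof. by apply: eq_bigr => i _; rewrite mulrC. Qed.

Lemma dotpDl u v w : dotp (u + v) w = dotp u w + dotp v w.
Proof. by rewrite /dotp -big_split; apply: eq_bigr => i _; rewrite mxE mulrDl. Qed.

Lemma dotpZl a u v : dotp (a *: u) v = a * dotp u v.
Proof. by rewrite /dotp mulr_sumr; apply: eq_bigr => i _; rewrite mxE mulrA. Qed.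

Lemma dotpDr u v w : dotp u (v + w) = dotp u v + dotp u w.
Proof. by rewrite dotpC dotpDl (dotpC v) (dotpC w). Qed.

Lemma dotpZr a u v : dotp u (a *: v) = a * dotp u v.
Proof. by rewrite dotpC dotpZl dotpC. Qed.

Lemma dotp0l u : dotp 0 u = 0.
Proof. by rewrite -(scale0r 0) dotpZl mul0r. Qed.

Lemma dotp_suml I (r : seq I) P (F : I -> 'cV[R]_n) v :
  dotp (\sum_(i <- r | P i) F i) v = \sum_(i <- r | P i) dotp (F i) v.
Proof. by elim/big_rec2: _ => [|i x y _ <-]; rewrite ?dotp0l ?dotpDl. Qed.

Lemma dotp_sumr I (r : seq I) P (F : I -> 'cV[R]_n) v :
  dotp v (\sum_(i <- r | P i) F i) = \sum_(i <- r | P i) dotp v (F i).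
Proof. by rewrite dotpC dotp_suml; apply: eq_bigr => i _; rewrite dotpC. Qed.

Lemma dotpp_ge0 u : 0 <= dotp u u.
Proof. by apply: sumr_ge0 => i _; rewrite -expr2 sqr_ge0. Qed.

Lemma dotpp_eq0 u : (dotp u u == 0) = (u == 0).
Proof.
rewrite psumr_eq0; last by move=> i _; rewrite -expr2 sqr_ge0.
apply/allP/eqP => [h|-> i _]; last by rewrite mxE mul0r eqxx.
apply/colP => i; rewrite mxE; have := h i (mem_index_enum _).
by rewrite mulf_eq0 orbb => /eqP.
Qed.

(** The parametrization used in [subspace_integral]; for an orthonormal [b] it is an isometry onto
    the span. *)
Definition frame_comb k (b : k.-tuple 'cV[R]_n) (y : k.-tuple RT) : 'cV[R]_n :=
  \sum_(i < k) (tnth y i : R) *: tnth b i.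

Definition orthonormal k (b : k.-tuple 'cV[R]_n) : Prop :=
  forall i j, dotp (tnth b i) (tnth b j) = (i == j)%:R.

Lemma measurable_frame_comb k (b : k.-tuple 'cV[R]_n) i :
  measurable_fun setT (fun y => frame_comb b y i 0).
Proof.
rewrite (_ : (fun _ => _) = (fun y : k.-tuple RT => \sum_(j < k) (tnth y j : R) * tnth b j i 0)).
  apply: measurable_sum => j; apply: measurable_funM => //; exact: measurable_tnth.
by apply/funext => y; rewrite summxE; apply: eq_bigr => j _; rewrite mxE.
Qed.

Lemma dotp_frame_comb k (b : k.-tuple 'cV[R]_n) (y : k.-tuple RT) : orthonormal b ->
  dotp (frame_comb b y) (frame_comb b y) = sqnorm_tuple y.
Proof.
move=> ob; rewrite dotp_suml; apply: eq_bigr => i _.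
rewrite dotpZl dotp_sumr (bigD1 i)//= big1 ?addr0.
  by rewrite dotpZr ob eqxx mulr1 expr2.
by move=> j ji; rewrite dotpZr ob eq_sym (negbTE ji) mulr0.
Qed.

Lemma frame_comb_shift k (b : k.-tuple 'cV[R]_n) (c y : k.-tuple RT) :
  frame_comb b (tuple_shift c y) = frame_comb b y + frame_comb b c.
Proof.
rewrite /frame_comb -big_split; apply: eq_bigr => i _ /=.
by rewrite tnth_mktuple scalerDl.
Qed.

Lemma measurable_dotp d (T : measurableType d) (phi psi : T -> 'cV[R]_n) :
  (forall i, measurable_fun setT (fun t => phi t i 0)) ->
  (forall i, measurable_fun setT (fun t => psi t i 0)) ->
  measurable_fun setT (fun t => dotp (phi t) (psi t)).
Proof. by move=> mphi mpsi; apply: measurable_sum => i; exact: measurable_funM. Qed.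

End isometry.

(** * Euclidean invariance of Lebesgue measure *)

Section weight.
Context {R : realType}.
Notation RT := (measurableTypeR R).
Notation mu := (@lebesgue_measure R).

(** The model case of [tail_decay]; the absolute value makes it continuous on the whole line, as
    that predicate demands. *)
Definition weight (nu s : R) : R := (1 + `|s|) `^ (- nu).

Lemma weight_ge0 nu s : 0 <= weight nu s.
Proof. exact: powR_ge0. Qed.

Lemma weight_continuous nu : continuous (weight nu).
Proof.
move=> s; rewrite /weight.
apply: (@continuous_comp _ _ _ (fun s : R => 1 + `|s|) (@powR R ^~ (- nu))).
  by apply: cvgD; [exact: cvg_cst|exact: norm_continuous].
apply: differentiable_continuous; apply/derivable1_diffP.
by apply: derivable_powR; rewrite in_itv/= andbT ltr_pwDl.
Qed.

Lemma tail_decay_weight nu : tail_decay nu (weight nu).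
Proof.
split; first exact: weight_continuous.
by exists 1 => s s0; rewrite mul1r ger0_norm ?weight_ge0// /weight ger0_norm.
Qed.

Lemma iter_tail_integral_weight nu m : m%:R < nu -> exists2 c, 0 < c &
  forall s, 0 <= s -> iter m tail_integral (weight nu) s = c * (1 + s) `^ (- (nu - m%:R)).
Proof.
elim: m => [|m IH] mnu.
  by exists 1 => // s s0; rewrite mul1r /= subr0 /weight ger0_norm.
have mnu' : m%:R < nu by apply: lt_trans mnu; rewrite ltr_nat.
have [c c0 hc] := IH mnu'.
have numm : 1 < nu - m%:R by rewrite ltrBrDr addrC natr1.
exists (c * (nu - m%:R - 1)^-1); first by rewrite mulr_gt0// invr_gt0 subr_gt0.
have -> : nu - m.+1%:R = nu - m%:R - 1 by rewrite -natr1; ring.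
move=> s s0; rewrite -mulrA; apply: EFin_inj.
rewrite EFinM -integral_powR_tail//= -integralZl//; last first.
  have := integrable_powR_tail 1 numm s0.
  by under [X in mu.-integrable _ X]eq_fun do rewrite mul1r.
rewrite /tail_integral fineK; last first.
  apply: integrable_fin_num => //.
  exact: tail_decay_integrable s numm (tail_decay_iter mnu' (tail_decay_weight nu)).
apply: eq_integral => u; rewrite inE/= in_itv/= andbT => su.
by rewrite hc// (le_trans s0).
Qed.

(** The exponent [m + 1] in the squared norm exceeds [m], which gives integrability over dimension
    [2m]. Both finiteness and positivity matter: the constant is cancelled in
    [ge0_integral_frame]. *)
Lemma integral_weight m : exists2 c : R, 0 < c &
  (\int[@lebesgue_tuple R m.*2]_t (weight m.+1%:R (sqnorm_tuple t))%:E = c%:E)%E.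
Proof.
have mnu : m%:R < m.+1%:R :> R by rewrite ltr_nat.
have [c c0 hc] := iter_tail_integral_weight mnu.
exists (pi ^+ m * iter m tail_integral (weight m.+1%:R) 0).
  by rewrite hc// !mulr_gt0 ?exprn_gt0 ?pi_gt0// powR_gt0// addr0.
have := ge0_integral_radial mnu (tail_decay_weight _) (weight_ge0 _) (lexx 0).
by move=> <-; apply: eq_integral => t _; rewrite add0r.
Qed.

End weight.

Section isometric_integral.
Context {R : realType} {n m : nat}.
Notation RT := (measurableTypeR R).
Notation L := (@lebesgue_tuple R m.*2).

(* Tonelli applied to [w(|x|) f(u' + b' x + b y)] with [w] a radial weight:
   integrating first in [y] or, after a translation, first in [x] produces the
   two integrals times the same constant. *)
Lemma ge0_integral_frame (b b' : m.*2.-tuple 'cV[R]_n) (u u' : 'cV[R]_n)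
    (f : 'cV[R]_n -> R) :
  orthonormal b -> orthonormal b' ->
  (forall y, exists z, frame_comb b y = frame_comb b' z) ->
  (forall y, exists z, frame_comb b' y = frame_comb b z) ->
  (exists z, u' = u + frame_comb b z) ->
  continuous f -> (forall v, 0 <= f v) ->
  (\int[L]_y (f (u + frame_comb b y))%:E = \int[L]_y (f (u' + frame_comb b' y))%:E)%E.
Proof.
move=> ob ob' bb' b'b [z0 ->] cf f0.
set u1 := u + _.
have [c c0 wc] := @integral_weight R m.
pose w := @weight R m.+1%:R.
have mw : measurable_fun setT w by apply: continuous_measurable_fun; exact: weight_continuous.
have w0 s : 0 <= w s by exact: weight_ge0.
suff cE : (c%:E * \int[L]_y (f (u + frame_comb b y))%:E =
   c%:E * \int[L]_y (f (u1 + frame_comb b' y))%:E)%E.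
  have := congr1 (fun z => (c^-1)%:E * z)%E cE.
  by rewrite !muleA -!EFinM mulVf ?gt_eqF// !mul1e.
have mfr d (T : measurableType d) (v : 'cV[R]_n) (phi : T -> 'cV[R]_n) :
    (forall i, measurable_fun setT (fun t => phi t i 0)) ->
    measurable_fun setT (fun t => (f (v + phi t))%:E).
  move=> mphi; apply/measurable_EFinP; apply: (measurable_continuous_comp (F := f)) => // i.
  rewrite (_ : (fun _ => _) = fun t => v i 0 + phi t i 0); first exact: measurable_funD.
  by apply/funext => t; rewrite mxE.
have mfb y0 : measurable_fun setT (fun y : m.*2.-tuple RT => (f (y0 + frame_comb b y))%:E).
  by apply: mfr => i; exact: measurable_frame_comb.
have mws d (T : measurableType d) (phi : T -> R) : measurable_fun setT phi ->
    measurable_fun setT (fun t => (w (phi t))%:E).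
  by move=> mphi; apply/measurable_EFinP; exact: measurableT_comp.
have msq := @measurable_sqnorm_tuple R m.*2.
have mb1 i : measurable_fun setT (fun p : m.*2.-tuple RT * m.*2.-tuple RT => frame_comb b' p.1 i 0).
  by apply: (measurableT_comp (measurable_frame_comb b' i)).
have mb2 i : measurable_fun setT (fun p : m.*2.-tuple RT * m.*2.-tuple RT => frame_comb b p.2 i 0).
  by apply: (measurableT_comp (measurable_frame_comb b i)).
pose K1 (p : m.*2.-tuple RT * m.*2.-tuple RT) : \bar R :=
  ((w (sqnorm_tuple p.1))%:E * (f (u1 + (frame_comb b' p.1 + frame_comb b p.2)))%:E)%E.
have K10 p : (0 <= K1 p)%E by rewrite mule_ge0// lee_fin.
have mK1 : measurable_fun setT K1.
  apply: emeasurable_funM.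
    by apply: mws; apply: measurableT_comp => //.
  apply: mfr => i; under eq_fun do rewrite mxE.
  exact: measurable_funD.
(* [K2] is [K1] with [frame_comb b' p.1 + frame_comb b p.2] as the new first variable: [f] now
   depends on that variable alone and the weight on the difference of the two points. *)
pose K2 (p : m.*2.-tuple RT * m.*2.-tuple RT) : \bar R :=
  ((f (u1 + frame_comb b' p.1))%:E *
   (w (dotp (frame_comb b' p.1 - frame_comb b p.2) (frame_comb b' p.1 - frame_comb b p.2)))%:E)%E.
have K20 p : (0 <= K2 p)%E by rewrite mule_ge0// lee_fin.
have mK2 : measurable_fun setT K2.
  apply: emeasurable_funM; first exact: mfr.
  apply: mws; apply: measurable_dotp => i; under eq_fun do rewrite !mxE;
    exact: measurable_funB.
transitivity (\int[L]_x \int[L]_y K1 (x, y))%E.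
  rewrite -wc -ge0_integralZr//; last 3 first.
  - exact: mws.
  - by move=> y _; rewrite lee_fin.
  - by apply: integral_ge0 => y _; rewrite lee_fin.
  apply: eq_integral => x _; rewrite /K1/= ge0_integralZl//; last 3 first.
  - by under eq_fun do rewrite addrA; exact: mfb.
  - by move=> y _; rewrite lee_fin.
  - by rewrite lee_fin.
  congr (_ * _)%E; have [d hd] := b'b x.
  (* This shift adds the coordinates in [b] of both [u1 - u] and [frame_comb b' x]. *)
  rewrite -(ge0_integral_tuple_shift (tuple_shift z0 d))//; last first.
  - by move=> y; rewrite lee_fin.
  apply: eq_integral => y _; congr (f _)%:E.
  rewrite !frame_comb_shift hd /u1 -!addrA; congr (_ + _).
  by rewrite addrA addrC; congr (_ + _); rewrite addrC.
rewrite (fubini_tonelli (m1 := L) (m2 := L) K1)//.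
transitivity (\int[L]_y \int[L]_x K2 (x, y))%E.
  apply: eq_integral => y _.
  have [d hd] := bb' y.
  pose nd : m.*2.-tuple RT := [tuple (- tnth d i : R) | i < m.*2].
  have hnd : frame_comb b' nd = - frame_comb b' d.
    rewrite /frame_comb -sumrN; apply: eq_bigr => i _.
    by rewrite tnth_mktuple scaleNr.
  have mK2y : measurable_fun setT (fun x => K2 (x, y)).
    exact: (measurableT_comp mK2 (pair2_measurable y)).
  rewrite -(ge0_integral_tuple_shift d mK2y (fun x => K20 (x, y))).
  apply: eq_integral => x _; rewrite /K1 /K2/= muleC frame_comb_shift hd.
  by rewrite addrK dotp_frame_comb.
rewrite -(fubini_tonelli (m1 := L) (m2 := L) K2)//.
rewrite -wc muleC -ge0_integralZr//; last 3 first.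
- by apply: mfr => i; exact: measurable_frame_comb.
- by move=> y _; rewrite lee_fin.
- by rewrite wc lee_fin ltW.
have mwx x : measurable_fun setT (fun y : m.*2.-tuple RT =>
    (w (dotp (frame_comb b' x - frame_comb b y) (frame_comb b' x - frame_comb b y)))%:E).
  apply: (mws _ _ (fun y : m.*2.-tuple RT =>
    dotp (frame_comb b' x - frame_comb b y) (frame_comb b' x - frame_comb b y))).
  apply: measurable_dotp => i; under eq_fun do rewrite !mxE;
    by apply: measurable_funB => //; exact: measurable_frame_comb.
apply: eq_integral => x _.
have fx0 : (0 <= (f (u1 + frame_comb b' x))%:E)%E by rewrite lee_fin.
have wx0 y : [set: m.*2.-tuple RT] y -> (0 <= (w (dotp (frame_comb b' x - frame_comb b y)
    (frame_comb b' x - frame_comb b y)))%:E)%E by rewrite lee_fin.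
transitivity ((f (u1 + frame_comb b' x))%:E *
    \int[L]_y (w (dotp (frame_comb b' x - frame_comb b y)
      (frame_comb b' x - frame_comb b y)))%:E)%E.
  exact: (ge0_integralZl L measurableT (mwx x) wx0 fx0).
have [e he] := b'b x; congr (_ * _)%E.
rewrite -(ge0_integral_tuple_shift e (mwx x) (fun y => wx0 y I)).
apply: eq_integral => y _; rewrite frame_comb_shift he opprD addrA addrAC subrr sub0r.
by rewrite -scaleN1r dotpZl dotpZr !mulN1r opprK dotp_frame_comb.
Qed.
End isometric_integral.

(** * The rotation group *)

Lemma continuous_to_mx (R : realType) (T : topologicalType) p q (phi : T -> 'M[R]_(p, q)) :
  (forall i j, continuous (fun t => phi t i j)) -> continuous phi.
Proof.
move=> cphi t; apply/cvg_ballP => e e0.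
have : \forall s \near t, forall i j, ball (phi t i j) e (phi s i j).
  apply: filter_forall => i; apply: filter_forall => j.
  by have /cvg_ballP := cphi i j t; apply.
by apply: filterS => s hs; split.
Qed.

Lemma continuous_sumr (R : realType) (T : topologicalType) I (r : seq I)
    (P : pred I) (F : I -> T -> R) :
  (forall i, P i -> continuous (F i)) -> continuous (fun t => \sum_(i <- r | P i) F i t).
Proof.
move=> cF; apply: continuous_big => //; exact: add_continuous.
Qed.

Lemma probability_integral_cst (R : realType) d (T : measurableType d)
    (P : probability T R) (c : \bar R) :
  (\int[P]_x c = c)%E.
Proof.
have H := integral_cst P measurableT c.
apply: etrans H _; rewrite -[RHS]mule1; congr (_ * _)%E.
exact: probability_setT.
Qed.

Section orthogonal.
Context {R : realType} {n : nat}.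
Notation SO := (SO R n).
Notation SOB := (SO_borel R n).

Lemma SO_inv_subproof (g : SO) : (SO_mx g)^T \in @SO_set R n.
Proof.
have [og dg] := SO_mxP g; rewrite inE; split; last by rewrite det_tr.
by rewrite trmxK; exact: mulmx1C.
Qed.

Definition SO_inv (g : SO) : SO := exist (fun m => m \in @SO_set R n) _ (SO_inv_subproof g).

Lemma SO_mx_inj (g h : SO) : SO_mx g = SO_mx h -> g = h.
Proof. by case: g h => [g gS] [h hS] /= gh; apply: val_inj. Qed.

Lemma SO_mulVK (g h : SO) : SO_mul (SO_inv g) (SO_mul g h) = h.
Proof.
apply: SO_mx_inj; rewrite /SO_mx/= mulmxA.
by have [og _] := SO_mxP g; rewrite og mul1mx.
Qed.

Lemma SO_mulKV (g h : SO) : SO_mul g (SO_mul (SO_inv g) h) = h.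
Proof.
apply: SO_mx_inj; rewrite /SO_mx/= mulmxA.
by have [/mulmx1C og _] := SO_mxP g; rewrite og mul1mx.
Qed.

Lemma continuous_SO_mx : continuous (@SO_mx R n).
Proof. exact: (@initial_continuous (SO : Type) _ (fun g => SO_mx g)). Qed.

Lemma measurable_SO_open (U : set SO) : open U -> measurable (U : set SOB).
Proof. by move=> oU; apply: sub_sigma_algebra. Qed.

Lemma measurable_SO_entry i j : measurable_fun setT (fun g : SOB => SO_mx g i j).
Proof.
apply: (measurability _ (RGenOpens.measurableE R)).
move=> _ [_ [a [b ->] <-]]; rewrite setTI; apply: measurable_SO_open.
have : continuous ((fun M : 'M[R]_n => M i j) \o @SO_mx R n).
  move=> g; apply: continuous_comp; [exact: continuous_SO_mx|exact: coord_continuous].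
by move/continuousP; apply; exact: interval_open.
Qed.

Lemma measurable_SO_mulmx d (T : measurableType d) (phi : T -> SOB) (w : T -> 'cV[R]_n) :
  measurable_fun setT phi -> (forall i, measurable_fun setT (fun t => w t i 0)) ->
  forall i, measurable_fun setT (fun t => (SO_mx (phi t) *m w t) i 0).
Proof.
move=> mphi mw i; under eq_fun do rewrite mxE.
apply: measurable_sum => j; apply: measurable_funM => //.
exact: measurableT_comp (measurable_SO_entry i j) mphi.
Qed.

Lemma measurable_SO_trmulmx d (T : measurableType d) (phi : T -> SOB) (w : T -> 'cV[R]_n) :
  measurable_fun setT phi -> (forall i, measurable_fun setT (fun t => w t i 0)) ->
  forall i, measurable_fun setT (fun t => ((SO_mx (phi t))^T *m w t) i 0).
Proof.
move=> mphi mw i; under eq_fun do rewrite mxE.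
apply: measurable_sum => j; apply: measurable_funM => //.
under eq_fun do rewrite mxE.
exact: measurableT_comp (measurable_SO_entry j i) mphi.
Qed.

Lemma measurable_SO_mul (g : SO) : measurable_fun setT (SO_mul g : SOB -> SOB).
Proof.
apply: (@measurability _ _ SOB SOB _ _ (@open SO)) => //.
move=> _ [U oU <-]; rewrite setTI; apply: measurable_SO_open.
case: oU => V oV <-.
have cm : continuous (fun M : 'M[R]_n => SO_mx g *m M).
  apply: continuous_to_mx => i j; under eq_fun do rewrite mxE.
  apply: continuous_sumr => k _ M.
  apply: (@continuous_comp _ _ _ (fun M : 'M[R]_n => M k j) ( *%R (SO_mx g i k))).
    exact: coord_continuous.
  exact: mulrl_continuous.
exists ((fun M : 'M[R]_n => SO_mx g *m M) @^-1` V) => //.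
by move/continuousP : cm; apply.
Qed.

Variables (P : probability SOB R).
Hypothesis haarP : haar_probability P.

(** [haar_probability] speaks of images, the pushforward of preimages: the preimage under
    multiplication by [g] is the image under multiplication by its inverse. *)
Lemma ge0_haar_integral_mul (g : SO) (h : SOB -> \bar R) :
  measurable_fun setT h -> (forall x, 0 <= h x)%E ->
  (\int[P]_x h (SO_mul g x) = \int[P]_x h x)%E.
Proof.
move=> mh h0.
pose mf := isMeasurableFun.Build _ _ _ _ _ (measurable_SO_mul g).
pose f : {mfun SOB >-> SOB} := HB.pack (SO_mul g : SOB -> SOB) mf.
rewrite [RHS](eq_measure_integral (pushforward P f)); last first.
  move=> A mA _; rewrite /pushforward.
  transitivity (P [set SO_mul (SO_inv g) a | a in A]); first by rewrite haarP.
  congr (P _); apply/seteqP; split => x /=.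
    by move=> [a Aa <-]; rewrite /f/= SO_mulKV.
  by move=> Ax; exists (SO_mul g x) => //; rewrite SO_mulVK.
by rewrite ge0_integral_pushforward.
Qed.

Variables (F : 'cV[R]_n -> R).
Hypotheses (cF : continuous F) (F0 : forall v, 0 <= F v).

Let mFcomp d (T : measurableType d) (phi : T -> 'cV[R]_n) :
  (forall i, measurable_fun setT (fun t => phi t i 0)) ->
  measurable_fun setT (fun t => (F (phi t))%:E).
Proof. by move=> mphi; apply/measurable_EFinP; exact: measurable_continuous_comp. Qed.

(* Integrate F(g^-1 h w) over g and h in both orders. *)
Lemma ge0_haar_integral_tr (w : 'cV[R]_n) :
  (\int[P]_g (F (SO_mx g *m w))%:E = \int[P]_g (F ((SO_mx g)^T *m w))%:E)%E.
Proof.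
pose K (p : SOB * SOB) : \bar R := (F ((SO_mx p.1)^T *m (SO_mx p.2 *m w)))%:E.
have K0 p : (0 <= K p)%E by rewrite lee_fin.
have mK : measurable_fun setT K.
  apply: mFcomp; apply: measurable_SO_trmulmx => //.
  exact: measurable_SO_mulmx.
transitivity (\int[P]_g \int[P]_h K (g, h))%E.
  under [RHS]eq_integral => g _.
    rewrite (_ : \int[P]_h K (g, h) = \int[P]_h (F (SO_mx h *m w))%:E)%E; last first.
      rewrite -(ge0_haar_integral_mul (SO_inv g) (h := fun h => (F (SO_mx h *m w))%:E)).
      - by apply: eq_integral => h _; rewrite /K/= /SO_mx/= mulmxA.
      - by apply: mFcomp; apply: measurable_SO_mulmx.
      - by move=> x; rewrite lee_fin.
    over.
  by rewrite probability_integral_cst.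
rewrite (fubini_tonelli (m1 := P) (m2 := P) K)//.
under eq_integral => h _.
  rewrite (_ : \int[P]_g K (g, h) = \int[P]_g (F ((SO_mx g)^T *m w))%:E)%E; last first.
    rewrite -(ge0_haar_integral_mul (SO_inv h) (h := fun g => (F ((SO_mx g)^T *m w))%:E)).
    - by apply: eq_integral => g _; rewrite /K/= /SO_mx/= trmx_mul trmxK mulmxA.
    - by apply: mFcomp; apply: measurable_SO_trmulmx.
    - by move=> x; rewrite lee_fin.
  over.
by rewrite probability_integral_cst.
Qed.

(** Right invariance, in the form needed for spherical means: transposition turns right
    multiplication into left multiplication. *)
Lemma ge0_haar_integral_mulr (g : SO) (w : 'cV[R]_n) :
  (\int[P]_h (F (SO_mx h *m (SO_mx g *m w)))%:E = \int[P]_h (F (SO_mx h *m w))%:E)%E.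
Proof.
rewrite ge0_haar_integral_tr [RHS]ge0_haar_integral_tr.
rewrite -(ge0_haar_integral_mul (SO_inv g) (h := fun h => (F ((SO_mx h)^T *m w))%:E)).
- by apply: eq_integral => h _; rewrite /SO_mx/= trmx_mul trmxK mulmxA.
- by apply: mFcomp; apply: measurable_SO_trmulmx.
- by move=> x; rewrite lee_fin.
Qed.

End orthogonal.

(** * Transitivity of the rotation group on spheres *)

Section transitivity.
Context {R : realType} {n : nat}.
Implicit Types (u v w : 'cV[R]_n).

Lemma dotpE u v : dotp u v = (u^T *m v) 0 0.
Proof. by rewrite mxE; apply: eq_bigr => i _; rewrite mxE. Qed.

Lemma dotp_last_vec : (0 < n)%N -> dotp (@last_vec R n) last_vec = 1.
Proof.
case: n => // p _; rewrite /dotp (bigD1 ord_max)//= big1 ?addr0.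
  by rewrite !mxE/= eqxx mulr1.
by move=> i im; rewrite !mxE/= -val_eqE/= in im *; rewrite (negbTE im) mul0r.
Qed.

(* The Householder reflection along [u - v]. *)
Lemma orthogonal_transitive u v : dotp u u = dotp v v ->
  exists2 H : 'M[R]_n, H^T *m H = 1%:M & H *m u = v.
Proof.
move=> uv; have [->|neq] := eqVneq u v; first by exists 1%:M; rewrite ?trmx1 mul1mx.
pose a := u - v; have a0 : dotp a a != 0 by rewrite dotpp_eq0 subr_eq0.
have aTa : a^T *m a = (dotp a a)%:M.
  by apply/matrixP => i j; rewrite !ord1 -dotpE mxE mulr1n.
(* Because [u] and [v] have the same length; hence the reflection subtracts exactly [a = u - v] from
   [u]. *)
have au : dotp a u = dotp a a / 2.
  have dB (w : 'cV[R]_n) : dotp (u - v) w = dotp u w - dotp v w.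
    by rewrite -scaleN1r dotpDl dotpZl mulN1r.
  have aE : dotp a a = 2 * dotp a u.
    by rewrite /a !dB !(dotpC _ (u - v)) !dB -uv (dotpC v u); ring.
  by rewrite aE mulrC mulKf.
pose H : 'M[R]_n := 1%:M - (2 / dotp a a) *: (a *m a^T).
exists H.
  have HT : H^T = H by rewrite /H linearB/= linearZ/= trmx_mul trmxK trmx1.
  have AA : (a *m a^T) *m (a *m a^T) = dotp a a *: (a *m a^T).
    by rewrite mulmxA -(mulmxA a) aTa mul_mx_scalar -scalemxAl.
  rewrite HT /H; set s := 2 / _.
  rewrite mulmxBl mul1mx mulmxBr mulmx1 -scalemxAl -scalemxAr AA !scalerA.
  have -> : s * s * dotp a a = s + s by rewrite /s; field.
  by rewrite scalerDl opprB addrK subrK.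
rewrite /H mulmxBl mul1mx -scalemxAl -mulmxA.
have -> : a^T *m u = (dotp a u)%:M.
  by apply/matrixP => i j; rewrite !ord1 -dotpE mxE mulr1n.
rewrite mul_mx_scalar scalerA au (_ : _ * _ = 1); last by field.
by rewrite scale1r /a opprB addrC subrK.
Qed.

(* If the Householder reflection has determinant -1, it is composed with the
   reflection in the first coordinate, which fixes [last_vec] as [1 < n]. *)
Lemma SO_transitive (t : R) v : (1 < n)%N -> dotp v v = t ^+ 2 ->
  exists g : SO R n, SO_mx g *m (t *: last_vec) = v.
Proof.
move=> n1 vt.
have n0 : (0 < n)%N by exact: ltn_trans n1.
have [|H HH Hv] := @orthogonal_transitive (t *: last_vec) v.
  by rewrite dotpZl dotpZr dotp_last_vec// mulr1 -expr2.
pose D : 'M[R]_n := diag_mx (\row_(i < n) (if i == Ordinal n0 then -1 else 1)).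
have DT : D^T = D by rewrite tr_diag_mx.
have DD : D *m D = 1%:M.
  rewrite mulmx_diag -diag_const_mx; congr diag_mx; apply/rowP => i.
  by rewrite !mxE; case: ifP => _; rewrite ?mulrNN ?mulr1.
have detD : \det D = -1.
  rewrite det_diag (bigD1 (Ordinal n0))//= big1; first by rewrite mxE eqxx mulr1.
  by move=> i /negbTE i0; rewrite mxE i0.
have De : D *m last_vec = last_vec.
  apply/colP => i; rewrite mul_diag_mx !mxE; case: eqP => [->|_]; last by rewrite mul1r.
  by rewrite /= eqn_leq [(n.-1 <= 0)%N]leqNgt -subn1 subn_gt0 n1 andbF mulr0.
have : \det H ^+ 2 = 1 by rewrite expr2 -{1}det_tr -det_mulmx HH det1.
move=> /eqP; rewrite sqrf_eq1 => /orP[/eqP dH|/eqP dH].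
  have hS : H \in @SO_set R n by rewrite inE.
  by exists (exist (fun m => m \in @SO_set R n) _ hS).
have hS : H *m D \in @SO_set R n.
  rewrite inE; split; last by rewrite det_mulmx dH detD mulrNN mulr1.
  by rewrite trmx_mul mulmxA -(mulmxA D^T) HH mulmx1 DT DD.
exists (exist (fun m => m \in @SO_set R n) _ hS).
by rewrite /SO_mx/= -mulmxA -scalemxAr De.
Qed.

End transitivity.

(** * The k-plane transform in a rotated frame *)

Lemma integral_max_split (R : realType) d (T : measurableType d) (mu : {measure set T -> \bar R})
  (f : T -> R) :
  (\int[mu]_x (f x)%:E = \int[mu]_x (Num.max (f x) 0)%:E - \int[mu]_x (Num.max (- f x) 0)%:E)%E.
Proof.
rewrite integralE; congr (_ - _)%E; apply: eq_integral => x _.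
  by rewrite funeposE EFin_max.
by rewrite funenegE EFin_max.
Qed.

Lemma continuous_max0 (R : realType) (T : topologicalType) (f : T -> R) :
  continuous f -> continuous (fun t => Num.max (f t) 0).
Proof. by move=> cf t; apply: (@continuous_max _ _ f (cst 0)); [exact: cf|exact: cvg_cst]. Qed.

Section frames.
Context {R : realType} {n m : nat}.
Notation RT := (measurableTypeR R).
Notation L := (@lebesgue_tuple R m.*2).

(** Positive and negative parts agree separately, so the extended integrals agree even where they
    are infinite. *)
Lemma integral_frame (b b' : m.*2.-tuple 'cV[R]_n) (u u' : 'cV[R]_n)
    (f : 'cV[R]_n -> R) :
  orthonormal b -> orthonormal b' ->
  (forall y, exists z, frame_comb b y = frame_comb b' z) ->
  (forall y, exists z, frame_comb b' y = frame_comb b z) ->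
  (exists z, u' = u + frame_comb b z) ->
  continuous f ->
  (\int[L]_y (f (u + frame_comb b y))%:E = \int[L]_y (f (u' + frame_comb b' y))%:E)%E.
Proof.
move=> ob ob' bb' b'b uu' cf.
rewrite integral_max_split [RHS]integral_max_split; congr (_ - _)%E.
- apply: (ge0_integral_frame (f := fun v => Num.max (f v) 0) ob ob') => //.
    exact: continuous_max0.
  by move=> v; rewrite le_max lexx orbT.
- apply: (ge0_integral_frame (f := fun v => Num.max (- f v) 0) ob ob') => //.
    by apply: continuous_max0 => v; exact: (continuousN (cf v)).
  by move=> v; rewrite le_max lexx orbT.
Qed.

Lemma basis_frame_comb k (zeta : {vspace 'cV[R]_n}) (b : k.-tuple 'cV[R]_n) v :
  basis_of zeta b -> v \in zeta -> exists z, v = frame_comb b z.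
Proof.
move=> bz vz; exists [tuple (coord b i v : R) | i < k].
rewrite {1}(coord_basis bz vz); apply: eq_bigr => i _.
by rewrite tnth_mktuple -tnth_nth.
Qed.

Lemma frame_comb_basis k (zeta : {vspace 'cV[R]_n}) (b : k.-tuple 'cV[R]_n) z :
  basis_of zeta b -> frame_comb b z \in zeta.
Proof.
move=> bz; apply: memv_suml => i _; apply: memvZ.
by apply: (basis_mem bz); exact: mem_tnth.
Qed.

Definition SO_frame k (hk : (k <= n)%N) (g : SO R n) : k.-tuple 'cV[R]_n :=
  [tuple SO_mx g *m basis_vec (widen_ord hk i) | i < k].

Lemma dotp_basis_vec (i j : 'I_n) : dotp (basis_vec i : 'cV[R]_n) (basis_vec j) = (i == j)%:R.
Proof.
rewrite /dotp (bigD1 i)//= big1 ?addr0; first by rewrite !mxE !eqxx mul1r andbT.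
by move=> l /negbTE li; rewrite !mxE li mul0r.
Qed.

Lemma orthonormal_SO_frame k (hk : (k <= n)%N) g : orthonormal (SO_frame hk g).
Proof. by move=> i j; rewrite !tnth_mktuple dotp_SO dotp_basis_vec. Qed.

Lemma frame_comb_SO k (hk : (k <= n)%N) (g : SO R n) y :
  frame_comb (SO_frame hk g) y =
  SO_mx g *m \sum_(i < k) (tnth y i : R) *: basis_vec (widen_ord hk i).
Proof.
rewrite mulmx_sumr; apply: eq_bigr => i _.
by rewrite tnth_mktuple -scalemxAr.
Qed.

(** [cid] and [xget] return an unknown pair and an unknown basis. The point set alone determines the
    direction space, and [integral_frame] then replaces the unknown basis by columns of [g] and the
    unknown base point [u] by a point of the plane moving linearly with [r]. *)
Lemma kplane_transform_rotated (hk : (m.*2 <= n.-1)%N) (g : SO R n) (x : 'cV[R]_n) (r : R)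
    (f : 'cV[R]_n -> R) : continuous f ->
  kplane_transform f (rotated_kplane hk g x r) =
  fine (\int[L]_y (f (x + r *: (SO_mx g *m last_vec) +
     frame_comb (SO_frame (leq_trans hk (leq_pred n)) g) y))%:E)%E.
Proof.
move=> cf; set hk' := leq_trans _ _; rewrite /kplane_transform /kplane_coords.
case: cid => -[zeta u] [/= dz _ tau].
set c := x + _.
(* The direction consists of differences of points of the plane; [a0] is the parameter of the
   unknown base point [u]. *)
have zE v : v \in zeta <-> exists2 a, a \in coord_space m.*2 & v = SO_mx g *m a.
  have : (moved_plane m.*2 g x r) u.
    by rewrite tau; exists 0; rewrite /= ?mem0v ?addr0.
  move=> [a0 /= a0c ua0].
  split=> [vz|[a ac ->]].
    have : (moved_plane m.*2 g x r) (u + v) by rewrite tau; exists v.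
    move=> [a /= ac uva]; exists (a - a0); first by rewrite memvB.
    by rewrite mulmxBr; apply: (addrI u); rewrite -uva -ua0 [RHS]addrC !addrA subrK.
  have : (moved_plane m.*2 g x r) (SO_mx g *m (a + a0) + x + r *: (SO_mx g *m last_vec)).
    by exists (a + a0); rewrite //= memvD.
  rewrite tau => -[w /= vz uv]; suff <- : w = SO_mx g *m a by [].
  by apply: (addrI u); rewrite uv -ua0 mulmxDr [RHS]addrC !addrA.
have ci i : basis_vec (widen_ord hk' i) \in coord_space (R := R) (n := n) m.*2.
  apply/coord_spaceP => j kj; rewrite mxE (_ : (j == _) = false)//.
  by apply/negbTE; rewrite -val_eqE/= gtn_eqF// (leq_trans (ltn_ord i)).
have bz : basis_of zeta (SO_frame hk' g).
  rewrite basisEdim size_tuple dz leqnn andbT; apply/subvP => v /zE[a /coord_spaceP ac ->].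
  have -> : a = \sum_(i < m.*2) a (widen_ord hk' i) 0 *: basis_vec (widen_ord hk' i).
    apply/colP => j; rewrite summxE; have [jk|kj] := ltnP j m.*2.
      rewrite (bigD1 (Ordinal jk))//= big1 ?addr0.
        rewrite !mxE (_ : widen_ord hk' _ = j) ?eqxx ?mulr1//; exact: val_inj.
      move=> l lj; rewrite !mxE (_ : (j == _) = false) ?mulr0//.
      by apply: contraNF lj => /eqP jl; apply/eqP/val_inj; rewrite /= jl.
    rewrite ac// big1// => l _; rewrite !mxE (_ : (j == _) = false) ?mulr0//.
    by apply/negbTE; rewrite -val_eqE/= gtn_eqF// (leq_trans (ltn_ord l)).
  rewrite mulmx_sumr; apply: memv_suml => i _; rewrite -scalemxAr; apply: memvZ.
  apply: memv_span; apply/tnthP; exists i; by rewrite tnth_mktuple.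
have obz : orthonormal_basis zeta (SO_frame hk' g) by split => //; exact: orthonormal_SO_frame.
rewrite /subspace_integral.
(* The basis [obz] guarantees that [xget] returns an orthonormal basis and not its default, the zero
   tuple. *)
have := @xgetPex _ [tuple of nseq m.*2 0] (@orthonormal_basis R n m.*2 zeta) (ex_intro _ _ obz).
set b := xget _ _ => -[bb ob].
have := @integral_frame b (SO_frame hk' g) u c f ob (orthonormal_SO_frame _ _) _ _ _ cf.
rewrite /Rintegral => ->//.
- by move=> y; apply: (basis_frame_comb bz); exact: frame_comb_basis.
- by move=> y; apply: (basis_frame_comb bb); exact: frame_comb_basis.
- have [|z hz] := @basis_frame_comb _ zeta b (c - u) bb; last first.
    by exists z; rewrite -hz addrC subrK.
  have : (moved_plane m.*2 g x r) c.
    by exists 0; rewrite /= ?mem0v// mulmx0 add0r.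
  by rewrite tau => -[v /= vz <-]; rewrite addrC addKr.
Qed.

End frames.

(** * Spherical means and the shifted dual transform *)

Lemma bounded_integrable (R : realType) d (T : measurableType d) (P : probability T R)
  (h : T -> R) (C : R) : measurable_fun setT h -> (forall x, `|h x| <= C) ->
  P.-integrable setT (EFin \o h).
Proof.
move=> mh hC; apply: (@le_integrable _ _ _ P _ _ _ (EFin \o cst C)) => //.
- exact/measurable_EFinP.
- by move=> x _; rewrite /= lee_fin (le_trans (hC x))// ler_norm.
- exact: finite_measure_integrable_cst.
Qed.

Lemma weight_le1 (R : realType) (nu s : R) : 0 <= nu -> weight nu s <= 1.
Proof.
move=> nu0; rewrite /weight powRN invf_le1 ?powR_gt0 ?ltr_pwDl//.
have s1 : 1 <= 1 + `|s| by rewrite lerDl.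
by have := ler_powR s1 nu0; rewrite powRr0.
Qed.

Section spherical_mean.
Context {R : realType} {n : nat}.
Notation RT := (measurableTypeR R).
Notation SOB := (SO_borel R n).
Variable P : probability SOB R.
Implicit Types F : 'cV[R]_n -> R.

Definition spherical_mean F (t : R) : R :=
  \int[P]_g F (SO_mx g *m (t *: last_vec)).

(** The weight is taken at the squared norm, so [nu] is half the order of decay in the norm. *)
Definition radial_bound (C nu : R) F := forall v, `|F v| <= C * weight nu (dotp v v).

Lemma radial_bound_cst C nu F : 0 <= nu -> radial_bound C nu F -> forall v, `|F v| <= C.
Proof.
move=> nu0 FC v; apply: (le_trans (FC v)).
have w0 : 0 < weight nu (dotp v v) by rewrite powR_gt0// ltr_pwDl.
have C0 : 0 <= C.
  by rewrite -(pmulr_lge0 _ w0); apply: le_trans (FC v).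
by rewrite ler_piMr// weight_le1.
Qed.

Lemma measurable_SO_comp F (w : 'cV[R]_n) : continuous F ->
  measurable_fun setT (fun g : SOB => F (SO_mx g *m w)).
Proof.
move=> cF; apply: (measurable_continuous_comp cF).
exact: measurable_SO_mulmx.
Qed.

Lemma integrable_SO_comp F (w : 'cV[R]_n) C : continuous F -> (forall v, `|F v| <= C) ->
  P.-integrable setT (EFin \o (fun g : SOB => F (SO_mx g *m w))).
Proof.
move=> cF FC; apply: (bounded_integrable _ (C := C)) => //.
exact: measurable_SO_comp.
Qed.

Lemma continuous_mulmx_scale (M : 'M[R]_n) (v : 'cV[R]_n) :
  continuous (fun t : R => M *m (t *: v)).
Proof.
apply: continuous_to_mx => i j t.
under eq_fun do rewrite -scalemxAr mxE.
by apply: cvgMr_tmp; exact: cvg_id.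
Qed.

Lemma continuous_spherical_mean F C : continuous F -> (forall v, `|F v| <= C) ->
  continuous (spherical_mean F).
Proof.
move=> cF FC t.
have := @continuity_under_integral R _ SOB P (fun t g => F (SO_mx g *m (t *: last_vec)))
  setT measurableT (t - 1) (t + 1) _ _ (cst C) _ _ t.
apply.
- by move=> s _; exact: integrable_SO_comp.
- apply: aeW => g _ s _.
  apply: (@continuous_comp _ _ _ (fun t : R => SO_mx g *m (t *: last_vec)) F).
    exact: continuous_mulmx_scale.
  exact: cF.
- exact: finite_measure_integrable_cst.
- by move=> s _; apply: aeW => g _; exact: FC.
- by rewrite inE/= in_itv/= ltrBlDr !ltrDl ltr01.
Qed.

(** [Num.sqrt] is [0] on negative numbers, so the composite is continuous on the whole line. For
    [0 <= s] the points averaged have squared norm [s], where the weight is exactly the bound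
    wanted. *)
Lemma tail_decay_spherical_mean F C nu : (0 < n)%N -> 0 <= nu -> continuous F ->
  radial_bound C nu F -> tail_decay nu (spherical_mean F \o Num.sqrt).
Proof.
move=> n0 nu0 cF FC; have FC' := radial_bound_cst nu0 FC; split.
  move=> s; apply: continuous_comp; first exact: sqrt_continuous.
  exact: (continuous_spherical_mean cF FC').
exists C => s s0 /=; rewrite /spherical_mean.
have ic := integrable_SO_comp (Num.sqrt s *: last_vec) cF FC'.
rewrite (le_trans (le_normr_Rintegral _ ic))//.
have -> : C * (1 + s) `^ (- nu) = \int[P]_g cst (C * (1 + s) `^ (- nu)) g.
  rewrite Rintegral_cst// (_ : fine _ = 1) ?mulr1//.
  by rewrite -[RHS]/(fine 1%:E); congr fine; exact: probability_setT.
apply: le_Rintegral => //.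
- exact: integrable_norm ic.
- exact: finite_measure_integrable_cst.
- move=> g _ /=; rewrite (le_trans (FC _))// dotp_SO dotpZl dotpZr dotp_last_vec// mulr1 -expr2.
  by rewrite sqr_sqrtr// /weight ger0_norm.
Qed.

Lemma EFin_spherical_mean F C t : continuous F -> (forall v, `|F v| <= C) ->
  ((spherical_mean F t)%:E = \int[P]_g (F (SO_mx g *m (t *: last_vec)))%:E)%E.
Proof.
move=> cF FC; rewrite fineK//; apply: integrable_fin_num => //.
exact: (integrable_SO_comp _ cF FC).
Qed.

Hypothesis haarP : haar_probability P.

(** A rotation carries [t *: last_vec] to [w], and right invariance absorbs it. *)
Lemma spherical_mean_eq F C w t : (1 < n)%N -> continuous F -> (forall v, 0 <= F v) ->
  (forall v, `|F v| <= C) -> dotp w w = t ^+ 2 ->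
  (\int[P]_g (F (SO_mx g *m w))%:E = (spherical_mean F t)%:E)%E.
Proof.
move=> n1 cF F0 FC wt; have [h <-] := SO_transitive n1 wt.
by rewrite ge0_haar_integral_mulr// (EFin_spherical_mean _ cF FC).
Qed.

End spherical_mean.

Section shifted_dual_formula.
Context {R : realType} {n m : nat}.
Notation RT := (measurableTypeR R).
Notation SOB := (SO_borel R n).
Notation L := (@lebesgue_tuple R m.*2).
Variable P : probability SOB R.
Hypothesis haarP : haar_probability P.
Hypotheses (m0 : (0 < m)%N) (hk : (m.*2 <= n.-1)%N).
Let hk' : (m.*2 <= n)%N := leq_trans hk (leq_pred n).
Let n1 : (1 < n)%N.
Proof. by apply: leq_trans hk'; rewrite -addnn -(addn1 1) leq_add. Qed.

Let coordv (y : m.*2.-tuple RT) : 'cV[R]_n :=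
  \sum_(i < m.*2) (tnth y i : R) *: basis_vec (widen_ord hk' i).

Lemma shifted_point (r : R) (g : SO R n) y :
  r *: (SO_mx g *m last_vec) + frame_comb (SO_frame hk' g) y =
  SO_mx g *m (r *: last_vec + coordv y).
Proof. by rewrite frame_comb_SO mulmxDr -scalemxAr. Qed.

Lemma measurable_coordv i : measurable_fun setT (fun y => coordv y i 0).
Proof.
rewrite (_ : (fun _ => _) = (fun y : m.*2.-tuple RT =>
    \sum_(j < m.*2) (tnth y j : R) * (basis_vec (widen_ord hk' j) : 'cV[R]_n) i 0)).
  apply: measurable_sum => j; apply: measurable_funM => //; exact: measurable_tnth.
by apply/funext => y; rewrite summxE; apply: eq_bigr => j _; rewrite mxE.
Qed.

(** Pythagoras: [m.*2 <= n.-1] keeps the last coordinate out of the coordinate space. *)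
Lemma dotp_shifted_point r y :
  dotp (r *: last_vec + coordv y) (r *: last_vec + coordv y) = r ^+ 2 + sqnorm_tuple y.
Proof.
have n0 : (0 < n)%N by exact: ltn_trans n1.
have le0 : dotp (@last_vec R n) (coordv y) = 0.
  rewrite dotp_sumr big1// => i _; rewrite dotpZr /dotp big1 ?mulr0// => j _.
  rewrite !mxE; case: eqP => [jn|_]; last by rewrite mul0r.
  rewrite (_ : (j == _) = false) ?mulr0//; apply/negbTE.
  by rewrite -val_eqE/= jn gtn_eqF// (leq_trans (ltn_ord i)).
rewrite !dotpDl !dotpDr !dotpZl !dotpZr dotp_last_vec// (dotpC (coordv y) last_vec) le0.
rewrite !mulr0 addr0 add0r mulr1 -expr2; congr (_ + _).
rewrite -(@dotp_frame_comb R n _ [tuple basis_vec (widen_ord hk' i) | i < m.*2]).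
  by congr dotp; apply: eq_bigr => i _; rewrite tnth_mktuple.
by move=> i j; rewrite !tnth_mktuple dotp_basis_vec -val_eqE.
Qed.

Let measurable_shifted (F : 'cV[R]_n -> R) (r : R) : continuous F ->
  measurable_fun setT (fun p : SOB * m.*2.-tuple RT =>
    (F (SO_mx p.1 *m (r *: last_vec + coordv p.2)))%:E).
Proof.
move=> cF; apply/measurable_EFinP; apply: (measurable_continuous_comp cF).
apply: measurable_SO_mulmx => // i; under eq_fun do rewrite mxE.
apply: measurable_funD => //.
by apply: (measurableT_comp (measurable_coordv i)).
Qed.

Lemma ge0_shifted_dual_formula (F : 'cV[R]_n -> R) C nu r : m%:R < nu ->
  continuous F -> (forall v, 0 <= F v) -> radial_bound C nu F ->
  (\int[P]_g \int[L]_y (F (SO_mx g *m (r *: last_vec + coordv y)))%:E =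
  (pi ^+ m * iter m tail_integral (spherical_mean P F \o Num.sqrt) (r ^+ 2))%:E)%E.
Proof.
move=> mnu cF F0 FC.
have nu0 : 0 <= nu by rewrite (le_trans _ (ltW mnu)).
have FC' := radial_bound_cst nu0 FC.
have n0 : (0 < n)%N by exact: ltn_trans n1.
rewrite -(ge0_integral_radial (nu := nu))//; last 3 first.
- exact: tail_decay_spherical_mean FC.
- by move=> s; apply: Rintegral_ge0.
- by rewrite sqr_ge0.
rewrite (fubini_tonelli (m1 := P) (m2 := L)
  (fun p => (F (SO_mx p.1 *m (r *: last_vec + coordv p.2)))%:E))//; last 2 first.
- exact: measurable_shifted.
- by move=> p; rewrite lee_fin.
apply: eq_integral => y _ /=.
rewrite (spherical_mean_eq haarP n1 cF F0 FC' (t := Num.sqrt (r ^+ 2 + sqnorm_tuple y)))//.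
rewrite sqr_sqrtr ?dotp_shifted_point//.
by rewrite addr_ge0// ?sqr_ge0// sqnorm_tuple_ge0.
Qed.

(** The radial weight is an integrable majorant for every single [g], so [fine] never meets an
    infinite value. *)
Lemma shifted_dual_finite (F : 'cV[R]_n -> R) C nu r g : m%:R < nu ->
  continuous F -> radial_bound C nu F ->
  (\int[L]_y (F (SO_mx g *m (r *: last_vec + coordv y)))%:E)%E \is a fin_num.
Proof.
move=> mnu cF FC.
have mw : measurable_fun setT (fun y : m.*2.-tuple RT => weight nu (r ^+ 2 + sqnorm_tuple y)).
  apply: measurableT_comp; first by apply: continuous_measurable_fun; exact: weight_continuous.
  by apply: measurable_funD => //; exact: measurable_sqnorm_tuple.
have iw : L.-integrable setT (fun y => (weight nu (r ^+ 2 + sqnorm_tuple y))%:E).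
  apply/integrableP; split; first exact/measurable_EFinP.
  under eq_integral do rewrite gee0_abs ?lee_fin ?weight_ge0//.
  rewrite (ge0_integral_radial mnu (tail_decay_weight nu)) ?ltry ?sqr_ge0//.
  by move=> s; exact: weight_ge0.
apply: integrable_fin_num => //.
apply: (le_integrable _ _ _ (integrableZl _ C iw)) => //.
  by have := measurableT_comp (measurable_shifted r cF) (pair1_measurable (g : SOB)).
move=> y _; rewrite -EFinM/= lee_fin (le_trans (FC _))// dotp_SO dotp_shifted_point.
exact: ler_norm.
Qed.

Lemma ge0_shifted_dual_integrable (F : 'cV[R]_n -> R) C nu r : m%:R < nu ->
  continuous F -> (forall v, 0 <= F v) -> radial_bound C nu F ->
  P.-integrable setT (fun g => \int[L]_y (F (SO_mx g *m (r *: last_vec + coordv y)))%:E)%E.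
Proof.
move=> mnu cF F0 FC; apply/integrableP; split.
  have K0 (p : SOB * m.*2.-tuple RT) : (0 <= (F (SO_mx p.1 *m (r *: last_vec + coordv p.2)))%:E)%E.
    by rewrite lee_fin.
  by have := measurable_fun_fubini_tonelli_F (m2 := L) _ (measurable_shifted r cF) K0.
rewrite (eq_integral (fun g : SOB =>
  \int[L]_y (F (SO_mx g *m (r *: last_vec + coordv y)))%:E)%E); last first.
  by move=> g _; rewrite gee0_abs//; apply: integral_ge0 => y _; rewrite lee_fin.
by rewrite (ge0_shifted_dual_formula r mnu cF F0 FC) ltry.
Qed.

Lemma tail_integral_iterB nu (g1 g2 : R -> R) p : p%:R < nu ->
  tail_decay nu g1 -> tail_decay nu g2 ->
  iter p tail_integral (fun s => g1 s - g2 s) =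
  (fun s => iter p tail_integral g1 s - iter p tail_integral g2 s).
Proof.
move=> + g1d g2d; elim: p => [//|p IH] pnu.
have pnu' : p%:R < nu by apply: lt_trans pnu; rewrite ltr_nat.
have nup : 1 < nu - p%:R by rewrite ltrBrDr addrC natr1.
apply/funext => s; rewrite /= IH// [LHS]/tail_integral RintegralB//.
- exact: tail_decay_integrable nup (tail_decay_iter pnu' g1d).
- exact: tail_decay_integrable nup (tail_decay_iter pnu' g2d).
Qed.

(** Tonelli requires a sign: [F] is split into its positive and negative parts, which inherit
    continuity and the bound with the same [C], and both sides are additive in this splitting. *)
Lemma shifted_dual_formula (F : 'cV[R]_n -> R) C nu r : m%:R < nu ->
  continuous F -> radial_bound C nu F ->
  \int[P]_g fine (\int[L]_y (F (r *: (SO_mx g *m last_vec) + frame_comb (SO_frame hk' g) y))%:E)%E =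
  pi ^+ m * iter m tail_integral (spherical_mean P F \o Num.sqrt) (r ^+ 2).
Proof.
move=> mnu cF FC.
have nu0 : 0 <= nu by rewrite (le_trans _ (ltW mnu)).
have n0 : (0 < n)%N by exact: ltn_trans n1.
pose Fp v := Num.max (F v) 0; pose Fn v := Num.max (- F v) 0.
have cFp : continuous Fp by exact: continuous_max0.
have cFn : continuous Fn by apply: continuous_max0 => v; exact: (continuousN (cF v)).
have Fp0 v : 0 <= Fp v by rewrite le_max lexx orbT.
have Fn0 v : 0 <= Fn v by rewrite le_max lexx orbT.
have FpC : radial_bound C nu Fp.
  move=> v; rewrite ger0_norm// ge_max (le_trans (ler_norm _) (FC v)).
  by rewrite (le_trans _ (FC v)).
have FnC : radial_bound C nu Fn.
  move=> v; rewrite ger0_norm// ge_max (le_trans _ (FC v))/=.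
    by rewrite (le_trans _ (FC v)).
  by rewrite -normrN ler_norm.
have maxB (a : R) : a = Num.max a 0 - Num.max (- a) 0.
  have [a0|/ltW a0] := leP 0 a.
    by rewrite (@max_idPr _ _ (- a) 0 _) ?subr0// oppr_le0.
  by rewrite (@max_idPl _ _ (- a) 0 _) ?sub0r ?opprK// oppr_ge0.
pose A (G : 'cV[R]_n -> R) (g : SOB) : \bar R :=
  (\int[L]_y (G (SO_mx g *m (r *: last_vec + coordv y)))%:E)%E.
transitivity (\int[P]_g (fine (A Fp g) - fine (A Fn g))).
  apply: eq_Rintegral => g _.
  under eq_integral do rewrite shifted_point.
  rewrite integral_max_split fineB//.
  - exact: shifted_dual_finite cFp FpC.
  - exact: shifted_dual_finite cFn FnC.
have EA (G : 'cV[R]_n -> R) : continuous G -> radial_bound C nu G ->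
    EFin \o (fun g => fine (A G g)) = A G.
  move=> cG GC; apply/funext => g /=; rewrite fineK//; exact: shifted_dual_finite cG GC.
rewrite RintegralB//; last 2 first.
- by rewrite EA//; exact: ge0_shifted_dual_integrable FpC.
- by rewrite EA//; exact: ge0_shifted_dual_integrable FnC.
have IA (G : 'cV[R]_n -> R) : continuous G -> (forall v, 0 <= G v) -> radial_bound C nu G ->
    \int[P]_g fine (A G g) =
    pi ^+ m * iter m tail_integral (spherical_mean P G \o Num.sqrt) (r ^+ 2).
  move=> cG G0 GC; rewrite /Rintegral.
  rewrite (_ : (fun g => _) = A G); last exact: EA.
  by rewrite /A (ge0_shifted_dual_formula r mnu cG G0 GC).
rewrite (IA Fp)// (IA Fn)// -mulrBr; congr (_ * _).
have -> : spherical_mean P F \o Num.sqrt =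
    (fun s => (spherical_mean P Fp \o Num.sqrt) s - (spherical_mean P Fn \o Num.sqrt) s).
  apply/funext => s /=; rewrite /spherical_mean -RintegralB//; last 2 first.
  - exact: integrable_SO_comp cFp (radial_bound_cst nu0 FpC).
  - exact: integrable_SO_comp cFn (radial_bound_cst nu0 FnC).
  apply: eq_Rintegral => g _; exact: maxB.
rewrite (tail_integral_iterB (nu := nu))//.
- exact: tail_decay_spherical_mean FpC.
- exact: tail_decay_spherical_mean FnC.
Qed.

End shifted_dual_formula.

(** * Decay bounds and directional derivatives *)

Section bounds.
Context {R : realType} {n : nat}.
Implicit Types (g : 'cV[R]_n -> R).

(** The Euclidean ball lies in the cube of half-side [M], whose compactness is obtained for row
    vectors, hence the transposes. *)
Lemma continuous_bounded_enorm g (M : R) : continuous g ->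
  exists B, forall v, enorm v <= M -> `|g v| <= B.
Proof.
move=> cg; have [M0|M0] := ltP M 0.
  by exists 0 => v vM; have := le_lt_trans vM M0; rewrite ltNge sqrtr_ge0.
pose A : set 'rV[R]_n := [set v | forall i, `[- M, M]%classic (v 0 i)].
have cA : compact A.
  by apply: (@rV_compact _ _ (fun=> `[- M, M]%classic)) => i; exact: segment_compact.
have ctr : continuous (fun v : 'rV[R]_n => `|g v^T|).
  have ct : continuous (fun v : 'rV[R]_n => v^T : 'cV[R]_n).
    apply: continuous_to_mx => i j; under eq_fun do rewrite mxE; exact: coord_continuous.
  move=> v; apply: (@continuous_comp _ _ _ (fun v : 'rV[R]_n => g v^T) (fun x : R => `|x|)).
    apply: (@continuous_comp _ _ _ (fun v : 'rV[R]_n => v^T : 'cV[R]_n) g).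
      exact: ct.
    exact: cg.
  exact: norm_continuous.
have [||c Ac hc] := EVT_max_rV (f := fun v : 'rV[R]_n => `|g v^T|) _ cA.
- by exists 0 => i /=; rewrite mxE in_itv/= oppr_le0 M0.
- exact: continuous_subspaceT.
exists `|g c^T| => v vM; have := hc v^T; rewrite trmxK; apply.
rewrite inE => i /=; rewrite mxE in_itv/= -ler_norml (le_trans _ vM)//.
rewrite -sqrtr_sqr ler_sqrt ?dotpp_ge0// /dotp (bigD1 i)//= expr2 lerDl.
by apply: sumr_ge0 => j _; rewrite -expr2 sqr_ge0.
Qed.

Lemma decay_weight_bound g (mu : R) : 0 < mu -> continuous g ->
  (exists C M : R, forall x, M <= enorm x -> `|g x| <= C * enorm x `^ (- mu)) ->
  exists C, radial_bound C (mu / 2) g.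
Proof.
move=> mu0 cg [C [M gC]].
pose M1 := Num.max M 1.
have [B gB] := continuous_bounded_enorm M1 cg.
have mu20 : 0 <= mu / 2 by rewrite divr_ge0// ltW.
pose w0 := (1 + M1 ^+ 2) `^ (- (mu / 2)).
have w00 : 0 < w0 by rewrite powR_gt0// ltr_pwDl// sqr_ge0.
(* On the ball of radius [M1] the weight is at least [w0]. Outside it [1 <= |v|], which is why [M1]
   is at least [1], and [1 + |v|^2 <= 2 |v|^2] yields the power of [2]. *)
exists (Num.max (`|B| / w0) (`|C| * 2 `^ (mu / 2))) => v.
have D0 := dotpp_ge0 v.
rewrite maxr_pMl ?weight_ge0// le_max /weight (ger0_norm D0) powRN.
have [vM|Mv] := leP (enorm v) M1.
  apply/orP; left; rewrite (le_trans (gB v vM))// (le_trans (ler_norm _))//.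
  rewrite -mulrA ler_peMr// ler_pdivlMl// mulr1 /w0 powRN.
  rewrite lef_pV2 ?posrE ?powR_gt0 ?ltr_pwDl ?sqr_ge0//.
  apply: ge0_ler_powR; rewrite ?nnegrE ?addr_ge0 ?sqr_ge0// lerD2l.
  by rewrite -(sqr_sqrtr D0) lerXn2r// nnegrE ?sqrtr_ge0// (le_trans (sqrtr_ge0 _) vM).
apply/orP; right; move: Mv; rewrite gt_max => /andP[Mv v1].
rewrite (le_trans (gC v (ltW Mv)))// (le_trans (ler_wpM2r (powR_ge0 _ _) (ler_norm _)))//.
rewrite -mulrA ler_wpM2l//.
have vE : enorm v `^ (- mu) = (dotp v v `^ (mu / 2))^-1.
  by rewrite powRN /enorm -powR12_sqrt// -powRrM mulrC; congr ((_ `^ _)^-1); rewrite mulrC.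
have D1 : 1 <= dotp v v.
  by rewrite -(sqr_sqrtr D0) expr_ge1 ?sqrtr_ge0// ltW.
have D00 : 0 < dotp v v by exact: lt_le_trans D1.
rewrite vE ler_pdivlMr ?powR_gt0 ?ltr_pwDl// ler_pdivrMl ?powR_gt0// -powRM//.
apply: ge0_ler_powR; rewrite ?nnegrE ?addr_ge0 ?mulr_ge0//; lra.
Qed.

End bounds.

(** * Directional derivatives from continuous partial derivatives *)

Section chain_rule.
Context {R : realType} {n : nat}.
Implicit Types (g : 'cV[R]_n -> R).

Lemma is_derive_line g (z v : 'cV[R]_n) (t : R) : derivable g (z + t *: v) v ->
  is_derive t (1 : R) (fun s : R => g (z + s *: v)) ('D_v g (z + t *: v)).
Proof.
move=> dg.
have E : (fun h : R => h^-1 *: (((fun s => g (z + s *: v)) \o shift t) (h *: 1) - g (z + t *: v))) =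
         (fun h : R => h^-1 *: ((g \o shift (z + t *: v)) (h *: v) - g (z + t *: v))).
  apply/funext => h /=; congr (_ *: (g _ - _)).
  by rewrite scalerDl [h *: 1]mulr1 addrCA.
by apply: DeriveDef; rewrite /derivable/derive E.
Qed.

(** Applied with [L] a derivative to prove differentiability, and with [L = 0] as a Lipschitz
    estimate; [b] may have either sign because the difference quotients are two-sided. *)
Lemma mean_value_le (phi dphi : R -> R) (L e b : R) :
  (forall s, `|s| <= `|b| -> is_derive s (1 : R) phi (dphi s)) ->
  (forall s, `|s| <= `|b| -> `|dphi s - L| <= e) ->
  `|phi b - phi 0 - L * b| <= e * `|b|.
Proof.
move=> dp de.
have cphi s : `|s| <= `|b| -> {for s, continuous phi}.
  move=> sb; apply: differentiable_continuous; apply/derivable1_diffP.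
  by have := dp s sb => ?; exact: ex_derive.
have [b0|b0] := leP 0 b.
  have inb s : s \in `[0, b] -> `|s| <= `|b|.
    by rewrite in_itv/= => /andP[s0 sb]; rewrite !ger0_norm.
  have [s sb| |s sb ->] := @MVT_segment R phi dphi 0 b b0.
  - by apply: dp; exact: inb (subset_itv_oo_cc sb).
  - by apply/continuous_in_subspaceT => s; rewrite inE => /inb /cphi.
  by rewrite subr0 -mulrBl normrM ler_wpM2r// de// inb.
have inb s : s \in `[b, 0] -> `|s| <= `|b|.
  by rewrite in_itv/= => /andP[bs s0]; rewrite !ler0_norm ?lerN2// ltW.
have [s sb| |s sb E] := @MVT_segment R phi dphi b 0 (ltW b0).
- by apply: dp; exact: inb (subset_itv_oo_cc sb).
- by apply/continuous_in_subspaceT => s; rewrite inE => /inb /cphi.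
rewrite -[phi b - phi 0]opprB E sub0r mulrN opprK -mulrBl normrM ler_wpM2r//.
by apply: de; exact: inb.
Qed.

Lemma is_derive0_cvg (phi : R -> R) (l : R) :
  h^-1 * (phi h - phi 0) @[h --> 0^'] --> l -> is_derive (0 : R) (1 : R) phi l.
Proof.
move=> H.
have E : (fun h : R => h^-1 *: ((phi \o shift 0) (h *: (1 : R)) - phi 0)) =
         (fun h : R => h^-1 * (phi h - phi 0)).
  by apply/funext => h /=; rewrite [h *: 1]mulr1 addr0.
by apply: DeriveDef; rewrite /derivable/derive E; [exact: cvgP H|exact: cvg_lim H].
Qed.

(** The base point [x + h *: v] moves with [h], so derivability at [x] does not suffice: the mean
    value theorem brings in ['D_e g] at nearby points, and its continuity concludes. *)
Lemma is_derive_increment g (x v e : 'cV[R]_n) (c : R) :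
  (forall y, derivable g y e) -> continuous ('D_e g) ->
  is_derive (0 : R) (1 : R)
    (fun h : R => g (x + h *: v + (h * c) *: e) - g (x + h *: v)) (c * 'D_e g x).
Proof.
move=> dg cdg; apply: is_derive0_cvg.
rewrite mul0r !scale0r !addr0 subrr.
under eq_fun do rewrite subr0.
apply/cvgrPdist_le => eps eps0.
have e'0 : 0 < eps / (`|c| + 1) by rewrite divr_gt0// ltr_wpDl.
have /cvgrPdist_le/(_ _ e'0)/nbhs_normP[d /= d0 hd] := cdg x.
(* For [|s| <= |h * c|] the displacement [h *: v + s *: e] has norm at most [|h| * K]; the [1] makes
   [K] positive. *)
pose K := `|v| + `|c| * `|e| + 1.
have K0 : 0 < K by rewrite ltr_wpDl// addr_ge0// mulr_ge0.
near=> h.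
have h0 : h != 0 by near: h; exact: nbhs_dnbhs_neq.
have hK : `|h| < d / K.
  near: h; apply: dnbhs0_lt; exact: divr_gt0.
have := @mean_value_le (fun tau => g (x + h *: v + tau *: e))
  (fun tau => 'D_e g (x + h *: v + tau *: e)) ('D_e g x) (eps / (`|c| + 1)) (h * c).
rewrite scale0r addr0 => mv.
have {}mv : `|g (x + h *: v + (h * c) *: e) - g (x + h *: v) - 'D_e g x * (h * c)| <=
    eps / (`|c| + 1) * `|h * c|.
  apply: mv => [s _|s shc]; first exact: is_derive_line.
  rewrite distrC; apply: hd => /=; rewrite -addrA opprD addrA subrr sub0r normrN.
  rewrite (le_lt_trans (ler_normD _ _))// !normrZ.
  apply: (@le_lt_trans _ _ (`|h| * K)); last by rewrite -ltr_pdivlMr.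
  rewrite /K mulrDr mulrDr mulr1 -addrA lerD2l mulrA -normrM.
  by rewrite ler_wpDr// ler_wpM2r.
have -> : c * 'D_e g x - h^-1 * (g (x + h *: v + (h * c) *: e) - g (x + h *: v)) =
   - h^-1 * (g (x + h *: v + (h * c) *: e) - g (x + h *: v) - 'D_e g x * (h * c)) by field.
rewrite mulNr normrN normrM normfV ler_pdivrMl ?normr_gt0// (le_trans mv)//.
rewrite normrM mulrCA ler_wpM2l//.
have c1 : 0 < `|c| + 1 by rewrite ltr_wpDl.
by rewrite mulrAC ler_pdivrMr// ler_wpM2l ?lerDl// ltW.
Unshelve. all: by end_near. Qed.

(** The coordinates are moved one at a time, each contributing an increment handled by
    [is_derive_increment]; the list [r] makes this an induction. *)
Lemma is_derive_partials g (x w : 'cV[R]_n) (r : seq 'I_n) :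
  (forall i y, derivable g y (basis_vec i)) -> (forall i, continuous ('D_(basis_vec i) g)) ->
  is_derive (0 : R) (1 : R) (fun h : R => g (x + h *: \sum_(i <- r) w i 0 *: basis_vec i))
    (\sum_(i <- r) w i 0 * 'D_(basis_vec i) g x).
Proof.
move=> dg cdg; elim: r => [|a r IH].
  rewrite !big_nil (_ : (fun _ => _) = cst (g x)); first exact: is_derive_cst.
  by apply/funext => h; rewrite scaler0 addr0.
rewrite !big_cons; set v := \sum_(i <- r) w i 0 *: _ in IH *.
rewrite (_ : (fun _ => _) =
   (fun h : R => g (x + h *: v + (h * w a 0) *: basis_vec a) - g (x + h *: v)) +
   (fun h : R => g (x + h *: v))); last first.
  apply/funext => h; rewrite [RHS]subrK.
  by rewrite scalerDr scalerA -addrA [_ + h *: v]addrC.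
have := is_derive_increment x v (w a 0) (dg a) (cdg a) => H1.
exact: is_deriveD.
Qed.

Lemma sum_basis_vec (w : 'cV[R]_n) : \sum_i w i 0 *: basis_vec i = w.
Proof.
apply/colP => j; rewrite summxE (bigD1 j)//= big1 ?addr0; first by rewrite !mxE !eqxx mulr1.
by move=> i /negbTE ij; rewrite !mxE eq_sym ij mulr0.
Qed.

Lemma is_derive_direction g (x w : 'cV[R]_n) (t : R) :
  (forall i y, derivable g y (basis_vec i)) -> (forall i, continuous ('D_(basis_vec i) g)) ->
  is_derive t (1 : R) (fun s : R => g (x + s *: w))
    (\sum_i w i 0 * 'D_(basis_vec i) g (x + t *: w)).
Proof.
move=> dg cdg.
have := is_derive_partials (x + t *: w) w (index_enum 'I_n) dg cdg.
under eq_fun do rewrite sum_basis_vec; move=> H.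
have Hs : is_derive t (1 : R) (fun s : R => s - t) 1.
  rewrite (_ : (fun s => s - t) = id - cst t)//.
  by apply: is_derive_eq; rewrite subr0.
rewrite (_ : (fun s => _) = (fun h : R => g (x + t *: w + h *: w)) \o (fun s => s - t)); last first.
  by apply/funext => s /=; rewrite -addrA -scalerDl addrCA subrr addr0.
rewrite -[X in is_derive _ _ _ X]mulr1.
by apply: is_derive1_comp; rewrite ?subrr.
Qed.

End chain_rule.

(** * Derivatives of spherical means *)

Section directional.
Context {R : realType} {n : nat}.
Variables (k : nat) (f : 'cV[R]_n -> R).
Hypothesis fC : class_C k f.

(* [dirder p s w y] is the sum over multi-indices [i_1 ... i_p] of
   [w_(i_1) ... w_(i_p)] times the partial derivative of [pderivs s f] at [y]. *)
Fixpoint dirder (p : nat) (s : seq 'I_n) (w y : 'cV[R]_n) : R :=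
  if p is p'.+1 then \sum_i w i 0 * dirder p' (i :: s) w y else pderivs s f y.

Lemma is_derive_sumr (T : Type) (r : seq T) (F : T -> R -> R) (dF : T -> R) (t : R) :
  (forall i, is_derive t (1 : R) (F i) (dF i)) ->
  is_derive t (1 : R) (fun s => \sum_(i <- r) F i s) (\sum_(i <- r) dF i).
Proof.
move=> hF; elim: r => [|a r IH].
  rewrite big_nil (_ : (fun _ => _) = cst 0); first exact: is_derive_cst.
  by apply/funext => s; rewrite big_nil.
rewrite big_cons (_ : (fun _ => _) = F a + (fun s => \sum_(i <- r) F i s)).
  exact: is_deriveD.
by apply/funext => s; rewrite big_cons.
Qed.

(** Unfolding [dirder] moves one derivative from [p] into [s]; the total [p + size s] stays fixed,
    and the strict inequality leaves room for one more. *)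
Lemma is_derive_dirder p s (w x : 'cV[R]_n) (t : R) : (p + size s < k)%N ->
  is_derive t (1 : R) (fun t => dirder p s w (x + t *: w)) (dirder p.+1 s w (x + t *: w)).
Proof.
elim: p s => [|p IH] s sk.
  apply: is_derive_direction => [i y|i].
    by have [_] := fC (ltnW sk); apply.
  by have [] := fC (s := i :: s) sk.
apply: (is_derive_sumr _ (F := fun i t => w i 0 * dirder p (i :: s) w (x + t *: w))) => i.
have H := IH (i :: s) (eq_ind _ (fun q => (q < k)%N) sk _ (addSnnS _ _)).
exact: (is_deriveZ (w i 0) H).
Qed.

Lemma measurable_dirder p s d (T : measurableType d) (w y : T -> 'cV[R]_n) : (p + size s <= k)%N ->
  (forall i, measurable_fun setT (fun t => w t i 0)) ->
  (forall i, measurable_fun setT (fun t => y t i 0)) ->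
  measurable_fun setT (fun t => dirder p s (w t) (y t)).
Proof.
move=> + mw my; elim: p s => [|p IH] s sk /=.
  by apply: (measurable_continuous_comp (F := pderivs s f)) => //; have [] := fC sk.
apply: measurable_sum => i; apply: measurable_funM => //.
by apply: IH; rewrite /= addnS -addSn.
Qed.

Hypothesis fB : forall s, (size s <= k)%N -> exists B : R, forall y, `|pderivs s f y| <= B.

Lemma dirder_bounded p s : (p + size s <= k)%N -> exists B : R, forall (w y : 'cV[R]_n),
  (forall i, `|w i 0| <= 1) -> `|dirder p s w y| <= B.
Proof.
elim: p s => [|p IH] s sk.
  by have [B hB] := fB sk; exists B => w y _; exact: hB.
have /choice[B hB] (i : 'I_n) : exists B : R, forall (w y : 'cV[R]_n),
    (forall i, `|w i 0| <= 1) -> `|dirder p (i :: s) w y| <= B.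
  by apply: IH; rewrite /= addnS -addSn.
exists (\sum_i B i) => w y w1 /=.
rewrite (le_trans (ler_norm_sum _ _ _))//; apply: ler_sum => i _.
rewrite normrM (le_trans _ (hB i w y w1))// ler_piMl// w1.
Qed.

End directional.

Section spherical_derivatives.
Context {R : realType} {n k : nat}.
Notation SOB := (SO_borel R n).
Variable P : probability SOB R.
Variable f : 'cV[R]_n -> R.
Hypothesis fC : class_C k f.
Hypothesis fB : forall s, (size s <= k)%N -> exists B : R, forall y, `|pderivs s f y| <= B.
Hypothesis n0 : (0 < n)%N.

Definition pole (g : SO R n) : 'cV[R]_n := SO_mx g *m last_vec.

(** The candidate for the [p]-th derivative in [t] of the spherical mean about [x], already
    differentiated under the integral. *)
Definition sphder (p : nat) (x : 'cV[R]_n) (t : R) : R :=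
  \int[P]_g dirder f p [::] (pole g) (x + t *: pole g).

Lemma pole_le1 g i : `|pole g i 0| <= 1.
Proof.
rewrite -(@ler_pXn2r _ 2)// ?nnegrE// expr1n real_normK ?num_real//.
rewrite -(dotp_last_vec n0) -(dotp_SO g) /dotp (bigD1 i)//= expr2 lerDl.
by apply: sumr_ge0 => j _; rewrite -expr2 sqr_ge0.
Qed.

Lemma sphder0 x t : sphder 0 x t = spherical_mean P (fun v => f (x + v)) t.
Proof. by apply: eq_Rintegral => g _; rewrite /pole -scalemxAr. Qed.

Lemma measurable_pole d (T : measurableType d) (phi : T -> SOB) i : measurable_fun setT phi ->
  measurable_fun setT (fun t => pole (phi t) i 0).
Proof. by move=> mphi; apply: measurable_SO_mulmx. Qed.

Lemma measurable_sphder p x t : (p <= k)%N ->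
  measurable_fun setT (fun g : SOB => dirder f p [::] (pole g) (x + t *: pole g)).
Proof.
move=> pk; apply: (measurable_dirder fC); first by rewrite addn0.
  by move=> i; apply: measurable_pole.
move=> i; under eq_fun do rewrite !mxE.
apply: measurable_funD => //; apply: measurable_funM => //.
by have := @measurable_pole _ SOB id i (@measurable_id _ _ _); under eq_fun do rewrite mxE.
Qed.

(** One constant serves all orders and all centres [x]; the uniformity of the limit rests on it. *)
Lemma sphder_bounded : exists2 B : R, 0 <= B & forall p, (p <= k)%N ->
  forall (x : 'cV[R]_n) t g, `|dirder f p [::] (pole g) (x + t *: pole g)| <= B.
Proof.
have /choice[B hB] (p : nat) : exists B : R, (p <= k)%N -> forall (w y : 'cV[R]_n),
    (forall i, `|w i 0| <= 1) -> `|dirder f p [::] w y| <= B.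
  have [pk|pk] := leqP p k; last by exists 0.
  have [|B hB] := dirder_bounded fB (p := p) (s := [::]); first by rewrite addn0.
  by exists B.
exists (\sum_(p < k.+1) `|B p|); first exact: sumr_ge0.
move=> p pk x t g; rewrite (le_trans (hB p pk _ _ (pole_le1 g)))//.
rewrite (le_trans (ler_norm _))// (bigD1 (Ordinal (pk : p < k.+1)%N))//= lerDl.
exact: sumr_ge0.
Qed.

Lemma sphder_integrable p x t : (p <= k)%N ->
  P.-integrable setT (EFin \o (fun g : SOB => dirder f p [::] (pole g) (x + t *: pole g))).
Proof.
move=> pk; have [B _ hB] := sphder_bounded.
by apply: (bounded_integrable P (C := B)); [exact: measurable_sphder|exact: hB].
Qed.

Lemma sphder_le B : (forall p, (p <= k)%N ->
    forall (x : 'cV[R]_n) t g, `|dirder f p [::] (pole g) (x + t *: pole g)| <= B) ->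
  forall p x t, (p <= k)%N -> `|sphder p x t| <= B.
Proof.
move=> hB p x t pk; have ip := sphder_integrable x t pk.
rewrite (le_trans (le_normr_Rintegral _ ip))//.
have -> : B = \int[P]_g cst B g.
  rewrite Rintegral_cst// (_ : fine _ = 1) ?mulr1//.
  by rewrite -[RHS]/(fine 1%:E); congr fine; exact: probability_setT.
apply: le_Rintegral => //.
- exact: integrable_norm ip.
- exact: finite_measure_integrable_cst.
- by move=> g _; exact: hB.
Qed.

(** Differentiation under the integral; the constant [B] dominates, being integrable for a
    probability. *)
Lemma is_derive_sphder p x (t : R) : (p < k)%N ->
  is_derive t (1 : R) (sphder p x) (sphder p.+1 x t).
Proof.
move=> pk; have [B B0 hB] := sphder_bounded.
pose F (s : R) (g : SOB) := dirder f p [::] (pole g) (x + s *: pole g).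
have dF s g : is_derive s (1 : R) (F ^~ g) (dirder f p.+1 [::] (pole g) (x + s *: pole g)).
  by apply: (is_derive_dirder fC); rewrite addn0.
have t1 : (`]t - 1, t + 1[%classic : set R) t by rewrite /= in_itv/= ltrBlDr !ltrDl ltr01.
have iF s : (`]t - 1, t + 1[%classic : set R) s -> P.-integrable setT (EFin \o F s).
  by move=> _; apply: sphder_integrable; exact: ltnW.
have dF1 s g : (`]t - 1, t + 1[%classic : set R) s -> [set: SOB] g -> derivable (F ^~ g) s 1.
  by move=> _ _; have H := dF s g; exact: ex_derive.
have pE s g : partial1of2 F s g = dirder f p.+1 [::] (pole g) (x + s *: pole g).
  by rewrite partial1of2E; have H := dF s g; rewrite derive_val.
have iB : P.-integrable setT (EFin \o cst B) by exact: finite_measure_integrable_cst.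
have B0' (g : SOB) : 0 <= cst B g by [].
have ub s (g : SOB) : (`]t - 1, t + 1[%classic : set R) s -> [set: SOB] g ->
    `|partial1of2 F s g| <= cst B g.
  by move=> _ _; rewrite pE; exact: hB.
have H1 := derivable_under_integral measurableT t1 iF dF1 B0' iB ub.
have H2 := differentiation_under_integral measurableT t1 iF dF1 B0' iB ub.
apply: DeriveDef; first exact: H1.
rewrite -derive1E H2; apply: eq_Rintegral => g _.
by rewrite -pE.
Qed.

End spherical_derivatives.

(** * Derivatives of iterated tail integrals *)

Section gamma.
Context {R : realType}.
Notation mu := (@lebesgue_measure R).

Lemma cvgy_exprn_expRN p : (t ^+ p * expR (- t)) @[t --> +oo] --> (0 : R).
Proof.
apply/cvgrPdist_lt => e e0; near=> t.
have t0 : 0 < t by near: t; exact: nbhs_pinfty_gt.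
have te : p.+1`!%:R / e < t by near: t; apply: nbhs_pinfty_gt; exact: num_real.
rewrite sub0r normrN ger0_norm ?mulr_ge0 ?expR_ge0 ?exprn_ge0 ?ltW//.
rewrite expRN ltr_pdivrMr ?expR_gt0//.
apply: (@lt_le_trans _ _ (e * (t ^+ p.+1 / p.+1`!%:R))).
  have f0 : 0 < p.+1`!%:R :> R by rewrite ltr0n fact_gt0.
  rewrite exprS -[ltLHS]mul1r (_ : e * _ = (e * t / p.+1`!%:R) * t ^+ p); last first.
    by rewrite !mulrA mulrAC.
  rewrite ltr_pM2r ?exprn_gt0// ltr_pdivlMr// mul1r.
  by rewrite mulrC -ltr_pdivrMr.
rewrite ler_pM2l//; apply: le_trans (expR_ge1Dxn p (ltW t0)).
by rewrite lerDr.
Unshelve. all: by end_near. Qed.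

(** The antiderivative of [t ^+ p * expR (- t)] given by repeated integration by parts; it tends to
    [0] at infinity and is the opposite of [p!] at [0]. *)
Fixpoint gamma_primitive (p : nat) (t : R) : R :=
  if p is q.+1 then p%:R * gamma_primitive q t - t ^+ p * expR (- t) else - expR (- t).

Lemma is_derive_gamma_primitive p (t : R) :
  is_derive t (1 : R) (gamma_primitive p) (t ^+ p * expR (- t)).
Proof.
have dN : is_derive t (1 : R) (fun s : R => expR (- s)) (- expR (- t)).
  rewrite -mulrN1; apply: (@is_derive1_comp _ expR (fun s : R => - s)).
elim: p => [|p IH].
  rewrite expr0 mul1r -[X in is_derive _ _ _ X]opprK.
  exact: is_deriveN.
have dX : is_derive t (1 : R) (fun s : R => s ^+ p.+1) (p.+1%:R * t ^+ p).
  apply: DeriveDef; first exact: exprn_derivable.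
  by rewrite -derive1E exp_derive1.
rewrite (_ : gamma_primitive p.+1 = p.+1%:R *: gamma_primitive p -
  (fun s : R => s ^+ p.+1) * (fun s : R => expR (- s)))//.
apply: is_derive_eq; rewrite /GRing.scale/=; ring.
Qed.

(** For even [k] the argument [k / 2] in [sphere_area] is such an integer. *)
Lemma Gamma_nat p : Gamma (p.+1%:R : R) = p`!%:R.
Proof.
rewrite /Gamma /Rintegral.
have -> : (\int[mu]_(t in `]0%R, +oo[) (t `^ (p.+1%:R - 1) * expR (- t))%:E =
    \int[mu]_(t in `]0%R, +oo[) (t ^+ p * expR (- t))%:E)%E.
  apply: eq_integral => t; rewrite inE/= in_itv/= andbT => t0.
  by rewrite -natr1 addrK powR_mulrn// ltW.
have cf : continuous (fun t : R => t ^+ p * expR (- t)).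
  move=> t; apply: cvgM; first exact: exprn_continuous.
  apply: (@continuous_comp _ _ _ (fun s : R => - s) expR).
    exact: opp_continuous.
  exact: continuous_expR.
rewrite integral_itv_obnd_cbnd; last first.
  by apply/measurable_funTS/measurable_EFinP; exact: continuous_measurable_fun.
rewrite (@ge0_continuous_FTC2y _ _ (gamma_primitive p) _ 0).
- rewrite sub0e -EFinN/=; elim: p {cf} => [|p IH]/=; first by rewrite oppr0 expR0 opprK.
  by rewrite expr0n/= mul0r subr0 -mulrN IH factS natrM.
- by move=> t t0; rewrite mulr_ge0 ?expR_ge0 ?exprn_ge0.
- exact: continuous_subspaceT.
- elim: p {cf} => [|p IH] /=.
    by rewrite -oppr0; apply: cvgN; exact: cvgr_expR.
  rewrite -[0 in X in _ --> X](_ : p.+1%:R * 0 - 0 = 0); last by rewrite mulr0 subr0.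
  by apply: cvgB; [apply: cvgMl_tmp; exact: IH|exact: cvgy_exprn_expRN].
- by move=> t _; have H := is_derive_gamma_primitive p t; exact: ex_derive.
- apply: cvg_at_right_filter; apply: differentiable_continuous; apply/derivable1_diffP.
  by have H := is_derive_gamma_primitive p 0; exact: ex_derive.
- by move=> t _; have H := is_derive_gamma_primitive p t; rewrite derive1E derive_val.
Qed.

End gamma.

(** * The Leibniz recursion for the derivatives of [H p] *)

Section recursion.
Context {R : realType}.
Variables (m : nat) (N H : nat -> R -> R).
Hypothesis dN : forall j (r : R), (j < m)%N -> 0 < r -> is_derive r (1 : R) (N j) (N j.+1 r).
Hypothesis H0 : forall r : R, 0 < r -> H 0 r = N 0 r.
Hypothesis dH : forall p (r : R), (p < m)%N -> 0 < r ->
  is_derive r (1 : R) (H p.+1) (- 2 * (r * H p r)).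

(* [iterder p j] is the [j]-th derivative of [H p], computed by the Leibniz rule
   from [(H p.+1)' = - 2 r (H p)]. *)
Fixpoint iterder (p j : nat) (r : R) : R :=
  if p is q.+1 then
    if j is i.+1 then - 2 * (r * iterder q i r + i%:R * iterder q i.-1 r)
    else H q.+1 r
  else N j r.

Lemma iterder0 p r : 0 < r -> iterder p 0 r = H p r.
Proof. by case: p => [|p] r0 //=; rewrite H0. Qed.

(** [N] can be differentiated [m] times and each tail integral adds one more derivative, hence the
    range of [j]. *)
Lemma is_derive_iterder p j (r : R) : (p <= m)%N -> (j < m + p)%N -> 0 < r ->
  is_derive r (1 : R) (iterder p j) (iterder p j.+1 r).
Proof.
elim: p j r => [|p IH] j r pm jmp r0.
  by apply: dN => //; rewrite addn0 in jmp.
case: j jmp => [|j] jmp.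
  by rewrite /= mul0r addr0 iterder0//; exact: dH.
have jmp' : (j < m + p)%N by rewrite addnS in jmp.
have d1 := IH j r (ltnW pm) jmp' r0.
have jp' : (j.-1 < m + p)%N by apply: leq_ltn_trans jmp'; exact: leq_pred.
have d2 := IH j.-1 r (ltnW pm) jp' r0.
have -> : iterder p.+1 j.+1 = (- 2 : R) *: (id * iterder p j + j%:R *: iterder p j.-1).
  by apply/funext => s.
apply: is_derive_eq; rewrite /GRing.scale/= mulr1 /id.
(* For [j = 0] the meaningless predecessor [j.-1] carries the coefficient [0]. *)
case: j {jmp jmp' jp'} d1 d2 => [|j] d1 d2 /=; first by rewrite mul0r addr0 mul1r.
rewrite -[j.+2%:R]natr1; ring.
Qed.

Fixpoint iterder_bound (B : R) (p i : nat) : R :=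
  if p is q.+1 then 2 * (iterder_bound B q i.+1 + (q.*2 + i).+1%:R * iterder_bound B q i)
  else B.

(** The derivative of order [2p + i] of [H p] reaches [N] only up to order [p + i]: one Leibniz term
    spends one derivative and gains a factor [r <= 1], the other spends two. *)
Lemma iterder_bounded B : (forall j (r : R), (j <= m)%N -> 0 < r -> `|N j r| <= B) ->
  forall p i (r : R), (p + i <= m)%N -> 0 < r -> r <= 1 ->
  `|iterder p (p.*2 + i) r| <= iterder_bound B p i.
Proof.
move=> NB; elim=> [|p IH] i r pim r0 r1 /=; first by rewrite NB.
rewrite normrM normrN (ger0_norm (ler0n _ _)) ler_pM2l// (le_trans (ler_normD _ _))//.
rewrite lerD//.
  rewrite normrM (gtr0_norm r0) addSnnS.
  rewrite (le_trans _ (IH i.+1 r _ r0 r1)) ?addnS// ler_piMl//.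
rewrite addSn normrM (ger0_norm (ler0n _ _)) ler_wpM2l//; apply: IH => //.
exact: leq_trans (leqnSn _) pim.
Qed.

(** The recursion without the terms carrying [r]: [- 2] comes from the derivative of [H p], and
    [2q + 1] counts the ways to differentiate the factor [r] once. *)
Fixpoint iterder_coef (p : nat) : R :=
  if p is q.+1 then - 2 * (q.*2.+1%:R * iterder_coef q) else 1.

Lemma iterder_coefE p : iterder_coef p * p`!%:R = (-1) ^+ p * p.*2`!%:R.
Proof.
elim: p => [|p IH]; first by rewrite !fact0 expr0.
rewrite /= factS natrM mulrCA -[in LHS]mulrA.
rewrite -mulrA IH doubleS !factS !natrM exprS.
rewrite (_ : p.*2.+2%:R = 2 * p.+1%:R :> R); first ring.
by rewrite -natrM mul2n doubleS.
Qed.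

Fixpoint iterder_error (B : R) (p : nat) : R :=
  if p is q.+1 then 2 * (iterder_bound B q 1 + q.*2.+1%:R * iterder_error B q) else 0.

(** At each level the discarded term has an explicit factor [r] times a derivative of order
    [2p + 1], bounded by [iterder_bounded] with [i = 1]; the kept term passes on the error of the
    level below. *)
Lemma iterder_main B : (forall j (r : R), (j <= m)%N -> 0 < r -> `|N j r| <= B) ->
  forall p (r : R), (p <= m)%N -> 0 < r -> r <= 1 ->
  `|iterder p p.*2 r - iterder_coef p * N 0 r| <= iterder_error B p * r.
Proof.
move=> NB; elim=> [|p IH] r pm r0 r1 /=; first by rewrite mul1r subrr normr0 mul0r.
have -> : - 2 * (r * iterder p p.*2.+1 r + p.*2.+1%:R * iterder p p.*2 r) -
    - 2 * (p.*2.+1%:R * iterder_coef p) * N 0 r =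
  - 2 * (r * iterder p p.*2.+1 r +
    p.*2.+1%:R * (iterder p p.*2 r - iterder_coef p * N 0 r)) by ring.
rewrite normrM normrN (ger0_norm (ler0n _ _)) -mulrA ler_pM2l// (le_trans (ler_normD _ _))//.
rewrite mulrDl lerD//.
  rewrite normrM (gtr0_norm r0) mulrC ler_wpM2r ?(ltW r0)//.
  by have := iterder_bounded NB (p := p) (i := 1) _ r0 r1; rewrite !addn1; apply.
rewrite normrM (ger0_norm (ler0n _ _)) -mulrA ler_wpM2l//.
by apply: IH => //; exact: ltnW.
Qed.

End recursion.

(** Each step differentiates an equality known only for positive arguments, which is legitimate
    because these form a neighbourhood of [r]. *)
Lemma iter_neg_deriv (R : realType) (F : R -> R) (G : nat -> R -> R) (k : nat) :
  (forall r : R, 0 < r -> F r = G 0 r) ->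
  (forall j (r : R), (j < k)%N -> 0 < r -> is_derive r (1 : R) (G j) (G j.+1 r)) ->
  (forall j (r : R), (j <= k)%N -> 0 < r -> iter j (@neg_deriv R) F r = (-1) ^+ j * G j r) /\
  (forall j (r : R), (j < k)%N -> 0 < r -> derivable (iter j (@neg_deriv R) F) r 1).
Proof.
move=> FG dG.
have dstep j (r : R) : (j < k)%N -> 0 < r ->
    (forall r : R, 0 < r -> iter j (@neg_deriv R) F r = (-1) ^+ j * G j r) ->
    is_derive r (1 : R) (iter j (@neg_deriv R) F) ((-1) ^+ j * G j.+1 r).
  move=> jk r0 E; have H : is_derive r (1 : R) (((-1) ^+ j : R) *: G j) ((-1) ^+ j * G j.+1 r).
    by have := dG j r jk r0 => ?; exact: is_deriveZ.
  apply: near_eq_is_derive H.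
  near=> s; rewrite [RHS]E//; near: s; exact: lt_nbhsr.
have E j (r : R) : (j <= k)%N -> 0 < r -> iter j (@neg_deriv R) F r = (-1) ^+ j * G j r.
  elim: j r => [|j IH] r jk r0; first by rewrite expr0 mul1r /= FG.
  rewrite iterS /neg_deriv derive1E.
  have H := dstep j r jk r0 (fun s s0 => IH s (ltnW jk) s0).
  by rewrite derive_val exprS mulN1r mulNr.
split=> // j r jk r0.
have H := dstep j r jk r0 (fun s s0 => E j s (ltnW jk) s0).
exact: ex_derive.
Unshelve. all: by end_near. Qed.

(** * The inversion formula *)

(* Peetre's inequality for the weights. *)
Lemma radial_bound_shift (R : realType) n (f : 'cV[R]_n -> R) (C nu : R) x : 0 <= nu ->
  radial_bound C nu f -> exists C', radial_bound C' nu (fun v => f (x + v)).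
Proof.
move=> nu0 fC; exists (`|C| * (2 * (1 + dotp x x)) `^ nu) => v.
rewrite (le_trans (fC _))// (le_trans (ler_wpM2r (weight_ge0 _ _) (ler_norm _)))//.
rewrite -mulrA ler_wpM2l// /weight !ger0_norm ?dotpp_ge0// !powRN.
have p1 (w : 'cV[R]_n) : 0 < 1 + dotp w w by rewrite ltr_pwDl// dotpp_ge0.
rewrite ler_pdivlMr ?powR_gt0// ler_pdivrMl ?powR_gt0// -powRM; last 2 first.
- exact: ltW.
- by rewrite mulr_ge0// ltW.
apply: ge0_ler_powR => //; rewrite ?nnegrE ?mulr_ge0 ?ltW//.
have h : 0 <= dotp (x + (x + v)) (x + (x + v)) by exact: dotpp_ge0.
(* The parallelogram law for [x] and [x + v], whose difference is [v] up to sign. *)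
have d : dotp v v = 2 * dotp x x + 2 * dotp (x + v) (x + v) - dotp (x + (x + v)) (x + (x + v)).
  rewrite !(dotpDl, dotpDr) (dotpC v x); ring.
have xx := dotpp_ge0 x; have yy := dotpp_ge0 (x + v).
rewrite d; nra.
Qed.

(** The constant is the inverse of the leading coefficient [pi^m (-1)^m (2m)! / m!]: with
    [2 pi^m / (m-1)!] as sphere area, the product reduces to the square of a sign times
    [(2m)! / (2m (2m-1)!)]. *)
Lemma inversion_const_coef (R : realType) m : (0 < m)%N ->
  inversion_const R m.*2 * pi ^+ m * iterder_coef m = 1.
Proof.
case: m => // q _.
have a := @iterder_coefE R q.+1.
have f0 : q.+1`!%:R != 0 :> R by rewrite pnatr_eq0 -lt0n fact_gt0.
have -> : iterder_coef q.+1 = (-1) ^+ q.+1 * q.+1.*2`!%:R / q.+1`!%:R :> R.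
  by rewrite -a mulfK.
rewrite /inversion_const /sphere_area doubleK.
have -> : q.+1.*2%:R / 2 = q.+1%:R :> R by rewrite -muln2 natrM mulfK.
rewrite Gamma_nat powR_mulrn ?pi_ge0//.
have p0 : (pi : R) ^+ q.+1 != 0 by rewrite expf_neq0// gt_eqF// pi_gt0.
have -> : q.+1.*2`!%:R = 2 * q.+1%:R * q.+1.*2.-1`!%:R :> R.
  by rewrite -natrM mul2n -natrM -[in LHS](prednK (n := q.+1.*2))// factS.
have -> : q.+1`!%:R = q.+1%:R * q`!%:R :> R by rewrite factS natrM.
have g0 : q.+1.*2.-1`!%:R != 0 :> R by rewrite pnatr_eq0 -lt0n fact_gt0.
have h0 : q`!%:R != 0 :> R by rewrite pnatr_eq0 -lt0n fact_gt0.
have q0 : q.+1%:R != 0 :> R by rewrite pnatr_eq0.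
have s1 : (-1) ^+ q.+1 * (-1) ^+ q.+1 = 1 :> R by rewrite -exprMn mulrNN mulr1 expr1n.
move: s1 p0 g0 h0 q0.
move: ((-1) ^+ q.+1) (pi ^+ q.+1) (q.+1.*2.-1`!%:R : R) (q`!%:R : R) (q.+1%:R : R) => s p g h q'.
move=> s1 p0 g0 h0 q0.
transitivity (s * s); last by [].
by field; rewrite p0 g0 h0 q0.
Qed.

Section inversion.
Context {R : realType} {n m : nat} {mu : R}.
Hypotheses (m0 : (0 < m)%N) (hkn : (m.*2 <= n.-1)%N) (hmu : m.*2%:R < mu).
Variable P : probability (SO_borel R n) R.
Hypothesis haarP : haar_probability P.
Variable f : 'cV[R]_n -> R.
Hypothesis hf : class_C_decay m.*2 mu f.

Let fC : class_C m.*2 f := hf.1.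
Let nu := mu / 2.

Let mnu : m%:R < nu.
Proof. by rewrite ltr_pdivlMr// -natrM muln2. Qed.

Let nu0 : 0 <= nu.
Proof. by rewrite (le_trans _ (ltW mnu)). Qed.

Let mu0 : 0 < mu.
Proof. by apply: le_lt_trans hmu. Qed.

Let n0 : (0 < n)%N.
Proof. by apply: leq_trans (leq_trans hkn (leq_pred n)); rewrite double_gt0. Qed.

Let f_bounded s : (size s <= m.*2)%N -> exists B : R, forall y, `|pderivs s f y| <= B.
Proof.
move=> sk; have [cs _] := fC sk.
have [C hC] := decay_weight_bound mu0 cs (hf.2 s sk).
by exists C; exact: radial_bound_cst hC.
Qed.

Let cf : continuous f.
Proof. by have [] := fC (s := [::]) isT. Qed.

Let F x (v : 'cV[R]_n) := f (x + v).

Let cF x : continuous (F x).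
Proof.
move=> v; apply: (@continuous_comp _ _ _ (fun v : 'cV[R]_n => x + v) f); last exact: cf.
by apply: (@continuousD _ _ _ (cst x) id); [exact: cst_continuous|move=> A].
Qed.

(** The constant depends on [x], which is harmless: it serves integrability and tail decay only,
    while the error estimate uses the bound of [sphder_bounded]. *)
Let F_bound x : exists C, radial_bound C nu (F x).
Proof.
have [C hC] := decay_weight_bound mu0 cf (hf.2 [::] isT).
exact: (radial_bound_shift x nu0 hC).
Qed.

Let Rstar := shifted_dual hkn P (@kplane_transform R n m.*2 f).
Let sm x := spherical_mean P (F x) \o Num.sqrt.
Let H x p (r : R) := iter p tail_integral (sm x) (r ^+ 2).
Let N x p (r : R) := sphder P f p x r.

Let Rstar_formula x r : Rstar x r = pi ^+ m * H x m r.
Proof.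
have [C hC] := F_bound x.
rewrite /H /sm -(shifted_dual_formula haarP m0 hkn r mnu (@cF x) hC).
apply: eq_Rintegral => g _; rewrite kplane_transform_rotated//; congr fine.
by apply: eq_integral => y _; rewrite /F addrA.
Qed.

Let sm_decay x : tail_decay nu (sm x).
Proof.
have [C hC] := F_bound x.
exact: (tail_decay_spherical_mean P n0 nu0 (@cF x) hC).
Qed.

Let H0E x r : 0 < r -> H x 0 r = N x 0 r.
Proof. by move=> r0; rewrite /H /N /sm/= sqrtr_sqr (gtr0_norm r0) sphder0. Qed.

Let dH x p (r : R) : (p < m)%N -> 0 < r ->
  is_derive r (1 : R) (H x p.+1) (- 2 * (r * H x p r)).
Proof.
move=> pm r0.
have pnu : p%:R < nu by apply: lt_trans mnu; rewrite ltr_nat.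
have pnu1 : 1 < nu - p%:R.
  by rewrite ltrBrDr addrC natr1; apply: le_lt_trans mnu; rewrite ler_nat.
have d1 := tail_integral_derive (r ^+ 2) pnu1 (tail_decay_iter pnu (sm_decay x)).
have d2 : is_derive r (1 : R) (fun s : R => s ^+ 2) (2 * r).
  by apply: DeriveDef; [exact: exprn_derivable|rewrite -derive1E exp_derive1 /= expr1].
have -> : - 2 * (r * H x p r) = - iter p tail_integral (sm x) (r ^+ 2) * (2 * r).
  by rewrite /H; ring.
exact: (@is_derive1_comp _ (tail_integral (iter p tail_integral (sm x))) (fun s : R => s ^+ 2)).
Qed.

Let dN x j (r : R) : (j < m)%N -> 0 < r -> is_derive r (1 : R) (N x j) (N x j.+1 r).
Proof.
move=> jm _; apply: (is_derive_sphder P fC f_bounded n0).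
by apply: leq_trans jm _; rewrite -addnn leq_addr.
Qed.

Let G x j (r : R) := pi ^+ m * iterder (N x) (H x) m j r.

Let iter_Rstar x :
  (forall j (r : R), (j <= m.*2)%N -> 0 < r ->
    iter j (@neg_deriv R) (Rstar x) r = (-1) ^+ j * G x j r) /\
  (forall j (r : R), (j < m.*2)%N -> 0 < r ->
    derivable (iter j (@neg_deriv R) (Rstar x)) r 1).
Proof.
apply: iter_neg_deriv => [r r0|j r jk r0].
  by rewrite Rstar_formula /G iterder0// => s; exact: H0E.
have d := is_derive_iterder (dN x) (H0E x) (dH x) (leqnn m) (j := j) (r := r).
rewrite addnn in d; have := d jk r0 => ?.
exact: (is_deriveZ (pi ^+ m)).
Qed.

Lemma shifted_dual_derivable x (j : nat) (r : R) : (j < m.*2)%N -> 0 < r ->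
  derivable (iter j (@neg_deriv R) (Rstar x)) r 1.
Proof. by have [_] := iter_Rstar x; apply. Qed.

(** Two errors of order [r], both independent of [x]: the Leibniz remainder, and the distance from
    the spherical mean of radius [r] to its value [f x] at radius [0]. *)
Lemma shifted_dual_inversion_rate : exists K : R, forall x (r : R), 0 < r -> r <= 1 ->
  `|f x - inversion_const R m.*2 * iter m.*2 (@neg_deriv R) (Rstar x) r| <= K * r.
Proof.
have [B B0 hB] := sphder_bounded f_bounded n0.
have NB := sphder_le P fC f_bounded n0 hB.
pose c := inversion_const R m.*2 * pi ^+ m.
exists (`|c| * iterder_error B m + B) => x r r0 r1.
have [-> // _] := iter_Rstar x.
rewrite -signr_odd odd_double expr0 mul1r /G mulrA -/c.
have main : `|iterder (N x) (H x) m m.*2 r - iterder_coef m * N x 0 r| <= iterder_error B m * r.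
  apply: (iterder_main (m := m)) => //.
  move=> j s jm s0; apply: NB; apply: leq_trans jm _; rewrite -addnn leq_addr//.
have N0 : N x 0 0 = f x.
  rewrite /N sphder0 /spherical_mean -[RHS]mulr1.
  have P1 : fine (P setT) = 1.
    by rewrite -[RHS]/(fine 1%:E); congr fine; exact: probability_setT.
  rewrite -P1 -Rintegral_cst//.
  by apply: eq_Rintegral => g _; rewrite scale0r mulmx0 addr0.
have near0 : `|N x 0 r - f x| <= B * r.
  have := @mean_value_le R (N x 0) (N x 1) 0 B r.
  rewrite N0 mul0r subr0 (gtr0_norm r0); apply.
    move=> s _; apply: (is_derive_sphder P fC f_bounded n0).
    by rewrite double_gt0.
  by move=> s _; rewrite subr0; apply: NB; rewrite double_gt0.
have ca : c * iterder_coef m = 1 by exact: inversion_const_coef.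
have -> : f x - c * iterder (N x) (H x) m m.*2 r =
  - (c * (iterder (N x) (H x) m m.*2 r - iterder_coef m * N x 0 r)) - (N x 0 r - f x).
  by rewrite mulrBr [c * (_ * _)]mulrA ca mul1r; ring.
rewrite mulrDl (le_trans (ler_normB _ _))// lerD// normrN normrM -mulrA.
by rewrite ler_wpM2l.
Qed.

Lemma shifted_dual_inversion :
  {uniform, (fun r x => inversion_const R m.*2 * iter m.*2 (@neg_deriv R) (Rstar x) r)
     @ 0^'+ --> f}.
Proof.
have [K hK] := shifted_dual_inversion_rate.
move=> A /uniform_nbhs[E [entE EA]].
have /= [e e0 eE] : exists2 e : R, 0 < e & [set xy | ball xy.1 e xy.2] `<=` E.
  by move: entE; rewrite -entourage_ballE => -[e /= e0 eE]; exists e.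
near=> r; apply: EA => x _; apply: eE => /=.
have r0 : 0 < r by near: r; exact: nbhs_right_gt.
have r1 : r <= 1 by near: r; exact: nbhs_right_le.
rewrite /ball/= (le_lt_trans (hK x r r0 r1))//.
apply: (@le_lt_trans _ _ ((`|K| + 1) * r)).
  by rewrite ler_wpM2r ?(ltW r0)// (le_trans (ler_norm _))// lerDl.
rewrite mulrC -ltr_pdivlMr ?ltr_wpDl//.
by near: r; apply: nbhs_right_lt; rewrite divr_gt0// ltr_wpDl.
Unshelve. all: by end_near. Qed.

End inversion.

Unset Implicit Arguments.

(** Since [derive1] is total, the derivability clause is what makes the iterated derivative in the
    limit a genuine one for [r > 0]. *)
Theorem proposition7p1 (R : realType) (n k : nat) (mu : R)
  (hk1 : (1 <= k)%N) (hkn : (k <= n.-1)%N) (hkeven : ~~ odd k)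
  (hmu : k%:R < mu)
  (haar : probability (SO_borel R n) R) (hhaar : haar_probability haar)
  (f : 'cV[R]_n -> R) (hf : class_C_decay k mu f) :
  let Rstar := shifted_dual hkn haar (@kplane_transform R n k f) in
  (forall x (j : nat) (r : R), (j < k)%N -> 0 < r ->
     derivable (iter j (@neg_deriv R) (Rstar x)) r 1) /\
  {uniform, (fun r x => inversion_const R k * iter k (@neg_deriv R) (Rstar x) r)
     @ 0^'+ --> f}.
Proof.
have [m km] : exists m, k = m.*2 by exists k./2; rewrite even_halfK.
subst k; have m0 : (0 < m)%N by rewrite -double_gt0.
split; first by move=> x j r; exact: (shifted_dual_derivable m0 hmu hhaar hf).
exact: (@shifted_dual_inversion _ _ _ _ m0 hkn hmu _ hhaar _ hf).
Qed.
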